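(* Let $|q|<1$ and let $k\geq 5$ be an integer. Then \[ \sum_{m_1,\dots,m_{k-2}\geq 0} \frac{q^{(m_1+m_2)^2+m_2^2+\cdots+m_{k-3}^2+m_{k-3}m_{k-2}}}{(q)_{m_1}(q)_{2m_2}} \Bigl(\prod_{j=3}^{k-3}\begin{bmatrix}m_{j-1}+m_j-m_{j+1}\\ 2m_j\end{bmatrix}\Bigr) \begin{bmatrix}m_{k-3}\\ m_{k-2}\end{bmatrix} =\frac{(q^{F_kF_{k-2}-1},q^{F_kF_{k-2}},q^{2F_kF_{k-2}-1};q^{2F_kF_{k-2}-1})_{\infty}}{(q;q)_{\infty}}. \]
   Context: $F_k$ denotes the Fibonacci numbers: $F_0=0$, $F_1=1$, $F_k=F_{k-1}+F_{k-2}$. $(x;q)_n=\prod_{i=0}^{n-1}(1-xq^i)$ (with $n=\infty$ allowed), $(q)_n=(q;q)_n$, and $(x_1,\dots,x_r;q)_\infty=\prod_{i=1}^r(x_i;q)_\infty$. The $q$-binomial coefficient is $\begin{bmatrix}n\\ m\end{bmatrix}=\frac{(q)_n}{(q)_m(q)_{n-m}}$ if $m$ and $n-m$ are nonnegative integers and $0$ otherwise. An empty product equals $1$. *)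

(* Defs.v *)
From HB Require Import structures.
From mathcomp Require Import all_boot all_order all_algebra.
From mathcomp Require Import complex.
From mathcomp Require Import all_classical all_reals topology normedtype sequences.
Set Implicit Arguments. Unset Strict Implicit. Unset Printing Implicit Defensive.
Import Order.TTheory GRing.Theory Num.Theory.
Import numFieldNormedType.Exports.
Local Open Scope classical_set_scope.
Local Open Scope ring_scope.

Fixpoint fib (n : nat) : nat :=
  match n with
  | 0 => 0
  | 1 => 1
  | (m.+1 as p).+1 => fib p + fib m
  end.

Section QSeries.
Variable C : numFieldType.

Definition qpoch (x q : C) (n : nat) : C := \prod_(i < n) (1 - x * q ^+ i).

Definition qpoch_inf (x q : C) : C := lim (qpoch x q @ \oo).

Definition qbinom (q : C) (n m : int) : C :=
  if (0 <= m) && (m <= n) then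
    qpoch q q `|n|%N / (qpoch q q `|m|%N * qpoch q q `|n - m|%N)
  else 0.

Fixpoint box_sum (d N : nat) (F : seq nat -> C) : C :=
  match d with
  | 0 => F [::]
  | d'.+1 => \sum_(i < N) box_sum d' N (fun s => F (nat_of_ord i :: s))
  end.

Definition summand (k : nat) (q : C) (s : seq nat) : C :=
  let m := fun j : nat => nth 0%N s j.-1 in
  q ^+ ((m 1%N + m 2%N) ^ 2 + \sum_(2 <= j < k - 2) (m j) ^ 2
         + m (k - 3)%N * m (k - 2)%N)%N
  / (qpoch q q (m 1%N) * qpoch q q (2 * m 2%N)%N)
  * (\prod_(3 <= j < k - 2)
       qbinom q ((m j.-1)%:Z + (m j)%:Z - (m j.+1)%:Z) (2 * m j)%N%:Z)
  * qbinom q (m (k - 3)%N)%:Z (m (k - 2)%N)%:Z.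

End QSeries.

(* Main.v *)
(* Every 1/(q)_m is read as a function of m : int that vanishes for m < 0, so
   that all q-binomial identities below hold without boundary cases.

   Put T(L,M,a,b) = [L+M+a-b; L+a] [L+M-a+b; L-a].  The Burge transform
     sum_i q^(i^2) [2L+M-i; 2L] T(i,L-i,b,a) = q^(b^2) T(L,M,a+b,b)
   follows from a q-Saalschuetz sum.  Summing the multisum from its last
   variable inwards starts with the q-Kummer evaluation
     q^(LM) [L+M; L] = sum_j (-1)^j q^(j(j+1)/2) T(L,M,j,j)
   and then applies the Burge transform once per remaining variable: this sends
   (a,b) to (a+b,a), so T(L,M,F_(n+2) j,F_(n+1) j) appears after n steps.  Two
   Bailey steps account for m_2 and m_1, and Jacobi's triple product sums the
   resulting theta series.  Since its exponent gains F_i^2 at each step, the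
   identity sum_(i <= n) F_i^2 = F_n F_(n+1) yields the modulus 2 F_k F_(k-2) - 1. *)
Require Import Defs.
From HB Require Import structures.
From mathcomp Require Import all_boot all_order all_algebra.
From mathcomp Require Import ring lra zify.
From mathcomp Require Import complex.
From mathcomp Require Import all_classical all_reals topology normedtype sequences exp.
Import Order.TTheory GRing.Theory Num.Theory.
Import numFieldNormedType.Exports.
Local Open Scope classical_set_scope.
Local Open Scope ring_scope.

(** * Finite q-series identities *)

Definition tri (j : int) : int := ((j * (j - 1)) %/ 2)%Z.

Lemma tri2 j : tri j + tri j = j * (j - 1).
Proof.
have -> : tri j + tri j = tri j * 2 by ring.
apply: divzK; rewrite dvdzE abszM.
have [h|h] : (2 %| absz j)%N \/ (2 %| absz (j - 1))%N by lia.
  by rewrite dvdn_mulr.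
by rewrite dvdn_mull.
Qed.

Lemma triS j : tri (j + 1) = tri j + j.
Proof. by have := tri2 j; have := tri2 (j + 1); nia. Qed.

Lemma fib_gt0 n : (0 < fib n.+1)%N.
Proof. by elim: n => [|n IH] //; rewrite -[fib _]/(fib n.+1 + fib n)%N; lia. Qed.

Lemma fibSS n : fib n.+2 = (fib n.+1 + fib n)%N.
Proof. by []. Qed.

(** These numbers become the coefficients of j^2 in the theta series, and their positivity gives the
    geometric decay in j. *)
Lemma fib_coef_gt0 m : (0 < fib m.+2 * fib m.+3 - 1)%N.
Proof. by rewrite (fibSS m.+1); have := fib_gt0 m; have := fib_gt0 m.+1; nia. Qed.

Section FiniteIdentities.
Variables (C : numFieldType) (q : C).

Definition ipoch (z : int) : C := if z is Posz n then (qpoch q q n)^-1 else 0.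
Arguments ipoch : simpl never.

Lemma qpoch0 (x Q : C) : qpoch x Q 0 = 1.
Proof. by rewrite /qpoch big_ord0. Qed.

Lemma qpochS (x Q : C) n : qpoch x Q n.+1 = qpoch x Q n * (1 - x * Q ^+ n).
Proof. by rewrite /qpoch big_ord_recr. Qed.

Hypothesis q_neq1 : forall n, q ^+ n.+1 != 1.

Lemma qpoch_neq0 n : qpoch q q n != 0.
Proof.
elim: n => [|n IHn]; first by rewrite qpoch0 oner_neq0.
by rewrite qpochS mulf_neq0 // -exprS subr_eq0 eq_sym.
Qed.
Hint Resolve qpoch_neq0 : core.

Lemma ipoch_lt0 z : z < 0 -> ipoch z = 0.
Proof. by case: z. Qed.

Lemma ipoch0 : ipoch 0 = 1.
Proof. by rewrite /ipoch /= qpoch0 invr1. Qed.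

(** There is no exception at z = -1: the factor 1 - q^0 vanishes, in agreement with [ipoch] being
    zero at negative arguments. *)
Lemma ipochS z : (1 - q ^ (z + 1)) * ipoch (z + 1) = ipoch z.
Proof.
case: z => [n|[|n]].
- rewrite -PoszD addn1 /ipoch qpochS -exprS exprnP invfM mulrCA mulfV ?mulr1 //.
  by rewrite subr_eq0 eq_sym -exprnP.
- by rewrite /= expr0z subrr mul0r.
- by rewrite (_ : Negz n.+1 + 1 = Negz n) ?mulr0 //; lia.
Qed.

Lemma ipochP z : (1 - q ^ z) * ipoch z = ipoch (z - 1).
Proof. by rewrite -[in RHS]ipochS subrK. Qed.

(** If n < 0, then m or n - m is negative and both sides vanish, so [absz] in the top index does no
    harm. *)
Lemma qbinomE n m : qbinom q n m = qpoch q q `|n|%N * ipoch m * ipoch (n - m).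
Proof.
rewrite /qbinom; case: ifP => [/andP[m0 mn]|].
  have -> : ipoch m = (qpoch q q `|m|%N)^-1 by case: m m0 mn.
  have -> : ipoch (n - m) = (qpoch q q `|n - m|%N)^-1.
    by move: mn; rewrite -subr_ge0; case: (n - m).
  by rewrite invfM mulrA.
have [m0 _|m0 /= mn] := ltP m 0; first by rewrite (ipoch_lt0 m m0) mulr0 mul0r.
by rewrite (ipoch_lt0 (n - m)) ?mulr0 //; lia.
Qed.

Hypothesis q_neq0 : q != 0.

Lemma expD a b : q ^ (a + b) = q ^ a * q ^ b.
Proof. exact: expfzDr. Qed.

(* c may be any integer: then ipoch cuts the range of r automatically *)
Lemma qvandermonde (A M : nat) (c : int) (n : nat) :
  ((M < n)%N || (A%:Z - c < n%:Z)) ->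
  \sum_(r < n) q ^ (r%:Z * (r%:Z + c)) * (ipoch (r%:Z + c) * ipoch (A%:Z - r%:Z - c)
                * ipoch r%:Z * ipoch (M%:Z - r%:Z)) =
  qpoch q q (A + M) / (qpoch q q A * qpoch q q M)
     * (ipoch (M%:Z + c) * ipoch (A%:Z - c)).
Proof.
elim: A c => [|A IH] c nP.
  rewrite qpoch0 mul1r add0n mulfV // mul1r.
  have zero (r : nat) : r%:Z + c <> 0 -> ipoch (r%:Z + c) * ipoch (0%:Z - r%:Z - c) = 0.
    move=> h; have [h1|h1] := ltP (r%:Z + c) 0; first by rewrite (ipoch_lt0 (r%:Z + c)) ?mul0r.
    by rewrite (ipoch_lt0 (_ - c)) ?mulr0 //; lia.
  have [c0|c0] := ltP 0 c.
    rewrite big1 => [|r _]; first by rewrite (ipoch_lt0 (0%:Z - c)) ?mulr0 //; lia.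
    by rewrite zero ?mul0r ?mulr0 //; lia.
  have [k ck] : exists k : nat, c = - k%:Z by exists `|c|%N; lia.
  (* For A = 0 only r = -c survives. If this index lies outside the range, [nP] leaves M < n <= -c,
     and the right-hand side vanishes as well. *)
  have [kn|kn] := ltnP k n.
    rewrite (bigD1 (Ordinal kn)) //= big1 => [|r rk].
      by rewrite ck addr0 addrN mulr0 expr0z mul1r sub0r addrN opprK ipoch0 !mul1r mulrC.
    rewrite zero ?mul0r ?mulr0 //; move: rk; rewrite -val_eqE /= => /eqP; lia.
  rewrite big1 => [|r _]; first by rewrite (ipoch_lt0 (M%:Z + c)) ?mul0r //; lia.
  by rewrite zero ?mul0r ?mulr0 //; have := ltn_ord r; lia.
have hA : 1 - q ^ A.+1%:Z != 0 by rewrite -exprnP subr_eq0 eq_sym.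
apply: (mulfI hA); rewrite mulr_sumr.
pose t (c' : int) (r : nat) := q ^ (r%:Z * (r%:Z + c')) * (ipoch (r%:Z + c') * ipoch (A%:Z - r%:Z - c')
                * ipoch r%:Z * ipoch (M%:Z - r%:Z)).
(* A q-Pascal step: 1 - q^(A+1) = (1 - X) + X(1 - Y) with X = q^(A+1-r-c) and Y = q^(r+c). The two
   parts are the sums for A at c and at c - 1. *)
transitivity (\sum_(r < n) t c r + q ^ (A.+1%:Z - c) * \sum_(r < n) t (c - 1) r).
  rewrite mulr_sumr -big_split /=; apply: eq_bigr => r _; rewrite /t.
  have -> : A%:Z - r%:Z - c = (A.+1%:Z - r%:Z - c) - 1 by lia.
  have -> : A%:Z - r%:Z - (c - 1) = A.+1%:Z - r%:Z - c by lia.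
  rewrite addrA -!ipochP.
  have -> : q ^ (r%:Z * (r%:Z + c)) = q ^ (r%:Z * (r%:Z + c - 1)) * q ^ r%:Z by rewrite -expD; congr (q ^ _); ring.
  have -> : q ^ A.+1%:Z = q ^ (A.+1%:Z - r%:Z - c) * q ^ (r%:Z + c) by rewrite -expD; congr (q ^ _); ring.
  have -> : q ^ (A.+1%:Z - c) = q ^ (A.+1%:Z - r%:Z - c) * q ^ r%:Z by rewrite -expD; congr (q ^ _); ring.
  ring.
rewrite !IH; try lia.
rewrite (_ : A.+1%:Z - c = A%:Z - c + 1) in nP *; last lia.
rewrite (_ : A%:Z - (c - 1) = A%:Z - c + 1); last lia.
rewrite addrA -(ipochP (M%:Z + c)) -(ipochS (A%:Z - c)).
rewrite addSn !qpochS -!exprS !exprnP.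
have -> : (A + M).+1%:Z = (A%:Z - c + 1) + (M%:Z + c) by lia.
rewrite (expD _ (M%:Z + c)).
field.
by rewrite -exprnP in hA; rewrite !qpoch_neq0 hA.
Qed.

(** The limit A -> oo of [qvandermonde], obtained by its own induction on M so that it stays a
    finite identity. *)
Lemma qvandermonde_inf (M : nat) (c : int) (n : nat) : (M < n)%N ->
  \sum_(r < n) q ^ (r%:Z * (r%:Z + c)) * (ipoch (r%:Z + c) * ipoch r%:Z * ipoch (M%:Z - r%:Z)) =
  ipoch M * ipoch (M%:Z + c).
Proof.
elim: M c n => [|M IH] c [//|n] Mn.
  rewrite big_ord_recl big1 => [|r _] /=.
    by rewrite mul0r expr0z subrr ipoch0 add0r; ring.
  by rewrite (ipoch_lt0 (0 - _)) ?mulr0 //; lia.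
have hM : 1 - q ^ M.+1%:Z != 0 by rewrite -exprnP subr_eq0 eq_sym.
apply: (mulfI hM); rewrite mulr_sumr.
pose t (c' : int) (r : nat) := q ^ (r%:Z * (r%:Z + c')) * (ipoch (r%:Z + c')
                * ipoch r%:Z * ipoch (M%:Z - r%:Z)).
(* The same splitting, now with X = q^(M+1-r) and Y = q^r. The second part contains 1/(q)_(r-1), so
   its index moves down by one and c becomes c + 1. *)
transitivity (\sum_(r < n.+1) t c r + q ^ (M.+1%:Z + c) * \sum_(r < n) t (c + 1) r).
  rewrite !mulr_sumr.
  have -> : \sum_(r < n) q ^ (M.+1%:Z + c) * t (c + 1) r =
     \sum_(r < n.+1) q ^ (r%:Z * (r%:Z + c) + M.+1%:Z - r%:Z) *
       (ipoch (r%:Z + c) * ipoch (r%:Z - 1) * ipoch (M.+1%:Z - r%:Z)).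
    rewrite big_ord_recl /= (ipoch_lt0 (0 - 1)) // mulr0 mul0r mulr0 add0r.
    apply: eq_bigr => r _; rewrite /t mulrA -expD /bump /=.
    have -> : (1 + r)%:Z - 1 = r by lia.
    have -> : M.+1%:Z - (1 + r)%:Z = M%:Z - r%:Z by lia.
    have -> : (1 + r)%:Z + c = r%:Z + (c + 1) by lia.
    by congr (q ^ _ * _); rewrite !PoszD -addn1 PoszD; ring.
  rewrite -big_split /=; apply: eq_bigr => r _; rewrite /t.
  have -> : M%:Z - r%:Z = (M.+1%:Z - r%:Z) - 1 by lia.
  rewrite -!ipochP.
  have -> : q ^ (r%:Z * (r%:Z + c) + M.+1%:Z - r%:Z) = q ^ (r%:Z * (r%:Z + c)) * q ^ (M.+1%:Z - r%:Z)
     by rewrite -expD; congr (q ^ _); ring.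
  have -> : q ^ M.+1%:Z = q ^ (M.+1%:Z - r%:Z) * q ^ r%:Z by rewrite -expD; congr (q ^ _); ring.
  ring.
rewrite !IH //; last by lia.
have -> : M.+1%:Z + c = M%:Z + c + 1 by lia.
have -> : M%:Z + (c + 1) = M%:Z + c + 1 by lia.
rewrite -(ipochS (M%:Z + c)) -(ipochS M%:Z).
have -> : M%:Z + 1 = M.+1 by lia.
ring.
Qed.

(** Together with [sum_ord_reflect], this brings the q-Vandermonde sums inside [qsaalschutz] to the
    common range below M + 1, where they can be interchanged. *)
Lemma sum_ord_shift (F : int -> C) (r n : nat) : (forall z, z < 0 -> F z = 0) ->
  \sum_(s < r + n) F (s%:Z - r%:Z) = \sum_(s < n) F s%:Z.
Proof.
move=> F0; rewrite big_split_ord /= big1 => [|s _]; last by rewrite F0 //; have := ltn_ord s; lia.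
by rewrite add0r; apply: eq_bigr => s _; congr (F _); lia.
Qed.

Lemma sum_ord_reflect (F : int -> C) (s n : nat) : (forall z, z < 0 -> F z = 0) ->
  \sum_(r < s.+1 + n) F (s%:Z - r%:Z) = \sum_(r < s.+1) F r%:Z.
Proof.
move=> F0; rewrite big_split_ord /= addrC big1 => [|r _]; last by rewrite F0 //; lia.
rewrite add0r (reindex_inj rev_ord_inj); apply: eq_bigr => r _ /=; congr (F _).
by have := ltn_ord r; lia.
Qed.

(* Expand the first binomial by q-Vandermonde; the sum over r then becomes
   another q-Vandermonde sum, and so does the remaining sum. *)
Lemma qsaalschutz (A B M c : nat) :
  \sum_(r < M.+1) q ^ (r%:Z * (r%:Z + c%:Z)) * (qpoch q q (A + B + M - r) * ipoch (M%:Z - r%:Z)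
     * (ipoch (A%:Z - r%:Z - c%:Z) * ipoch (B%:Z - r%:Z) * ipoch (r%:Z + c%:Z) * ipoch r%:Z)) =
  qpoch q q (A + B) * qpoch q q (B + M + c) * qpoch q q (A + M)
    / (qpoch q q A * qpoch q q B * qpoch q q M)
    * (ipoch (M%:Z + c%:Z) * ipoch (A%:Z - c%:Z) * ipoch (B%:Z + c%:Z)).
Proof.
have expand (r : nat) : (r <= M)%N ->
    qpoch q q (A + B + M - r) * ipoch (M%:Z - r%:Z) * ipoch (A%:Z - r%:Z - c%:Z) =
    \sum_(s < M.+1) qpoch q q (A + B) * qpoch q q (B + M + c) *
      (q ^ ((s%:Z - r%:Z) * (B%:Z + c%:Z + s%:Z)) * (ipoch (s%:Z - r%:Z) *
        ipoch (A%:Z - c%:Z - s%:Z) * ipoch (B%:Z + c%:Z + s%:Z) * ipoch (M%:Z - s%:Z))).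
  move=> rM; have [Ar|Ar] := ltnP A (r + c).
    rewrite (ipoch_lt0 (A%:Z - _ - _)) ?mulr0; last lia.
    rewrite big1 // => s _; have [sr|sr] := ltP (s%:Z - r%:Z) 0.
      by rewrite (ipoch_lt0 _ sr) !mul0r !mulr0.
    by rewrite (ipoch_lt0 (A%:Z - _ - _)) ?mulr0 ?mul0r ?mulr0 //; lia.
  have Ea : A%:Z - r%:Z - c%:Z = (A - r - c)%N by lia.
  rewrite Ea; set a := (A - r - c)%N.
  (* The parameters are chosen so that B + M + c + a = A + B + M - r, the index of the factor to be
     expanded. *)
  have := @qvandermonde (B + M + c) a (B + c + r)%:Z (M.+1 - r)%N.
  rewrite -[X in (_ -> X = _) -> _](sum_ord_shift (fun z => q ^ (z * (z + (B + c + r)%:Z)) *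
     (ipoch (z + (B + c + r)%:Z) * ipoch ((B + M + c)%:Z - z - (B + c + r)%:Z) * ipoch z * ipoch (a%:Z - z))) r); last first.
    by move=> z z0; rewrite (ipoch_lt0 z) // !(mulr0, mul0r).
  rewrite subnKC; last lia.
  rewrite -mulr_sumr.
  under eq_bigr => s _.
    have -> : s%:Z - r%:Z + (B + c + r)%:Z = B%:Z + c%:Z + s%:Z by lia.
    have -> : (B + M + c)%:Z - (s%:Z - r%:Z) - (B + c + r)%:Z = M%:Z - s%:Z by lia.
    have -> : a%:Z - (s%:Z - r%:Z) = A%:Z - c%:Z - s%:Z by lia.
    over.
  move=> V.
  transitivity (qpoch q q (A + B) * qpoch q q (B + M + c) *
     (\sum_(s < M.+1) q ^ ((s%:Z - r%:Z) * (B%:Z + c%:Z + s%:Z)) *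
      (ipoch (B%:Z + c%:Z + s%:Z) * ipoch (M%:Z - s%:Z) * ipoch (s%:Z - r%:Z)
         * ipoch (A%:Z - c%:Z - s%:Z)))).
    rewrite V; last lia.
    have -> : (B + M + c + a = A + B + M - r)%N by lia.
    have -> : a%:Z + (B + c + r)%:Z = (A + B)%N by lia.
    have -> : (B + M + c)%:Z - (B + c + r)%:Z = M%:Z - r%:Z by lia.
    rewrite /(ipoch (Posz (A+B))) /(ipoch (Posz a)); field.
    by rewrite !qpoch_neq0.
  by congr (_ * _); apply: eq_bigr => s _; ring.
have inner (s : nat) : (s <= M)%N ->
    \sum_(r < M.+1) q ^ ((B%:Z - r%:Z) * (s%:Z - r%:Z)) *
      (ipoch r%:Z * ipoch (B%:Z - r%:Z) * ipoch (s%:Z - r%:Z) * ipoch (r%:Z + c%:Z)) =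
    qpoch q q (B + (s + c)) / (qpoch q q B * qpoch q q (s + c)) * (ipoch (B%:Z + c%:Z) * ipoch s%:Z).
  move=> sM.
  have := @qvandermonde B (s + c) (B%:Z - s%:Z) s.+1.
  rewrite -[X in (_ -> X = _) -> _](sum_ord_reflect (fun z => q ^ (z * (z + (B%:Z - s%:Z))) *
     (ipoch (z + (B%:Z - s%:Z)) * ipoch (B%:Z - z - (B%:Z - s%:Z)) * ipoch z * ipoch ((s + c)%:Z - z))) _ (M - s)); last first.
    by move=> z z0; rewrite (ipoch_lt0 z) // !(mulr0, mul0r).
  rewrite addSn subnKC //.
  have -> : (s + c)%:Z + (B%:Z - s%:Z) = B%:Z + c%:Z by lia.
  have -> : B%:Z - (B%:Z - s%:Z) = s by lia.
  move=> <-; last lia.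
  apply: eq_bigr => r _.
  have -> : s%:Z - r%:Z + (B%:Z - s%:Z) = B%:Z - r%:Z by lia.
  have -> : B%:Z - (s%:Z - r%:Z) - (B%:Z - s%:Z) = r by lia.
  have -> : (s + c)%:Z - (s%:Z - r%:Z) = r%:Z + c%:Z by lia.
  by rewrite (mulrC (B%:Z - r%:Z)); ring.
transitivity (\sum_(r < M.+1) \sum_(s < M.+1) qpoch q q (A + B) * qpoch q q (B + M + c) *
   (q ^ (s%:Z * (s%:Z + c%:Z)) * (ipoch (A%:Z - s%:Z - c%:Z) * ipoch (B%:Z + c%:Z + s%:Z) * ipoch (M%:Z - s%:Z))
   * (q ^ ((B%:Z - r%:Z) * (s%:Z - r%:Z)) *
      (ipoch r%:Z * ipoch (B%:Z - r%:Z) * ipoch (s%:Z - r%:Z) * ipoch (r%:Z + c%:Z))))).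
  apply: eq_bigr => r _; have rM : (r <= M)%N by have := ltn_ord r; lia.
  transitivity (qpoch q q (A + B + M - r) * ipoch (M%:Z - r%:Z) * ipoch (A%:Z - r%:Z - c%:Z)
     * (q ^ (r%:Z * (r%:Z + c%:Z)) * (ipoch (B%:Z - r%:Z) * ipoch (r%:Z + c%:Z) * ipoch r%:Z))).
    by ring.
  rewrite expand // mulr_suml; apply: eq_bigr => s _.
  have -> : A%:Z - c%:Z - s%:Z = A%:Z - s%:Z - c%:Z by ring.
  transitivity (q ^ ((s%:Z - r%:Z) * (B%:Z + c%:Z + s%:Z) + r%:Z * (r%:Z + c%:Z)) *
     (qpoch q q (A + B) * qpoch q q (B + M + c) * (ipoch (A%:Z - s%:Z - c%:Z) * ipoch (B%:Z + c%:Z + s%:Z) * ipoch (M%:Z - s%:Z))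
     * (ipoch r%:Z * ipoch (B%:Z - r%:Z) * ipoch (s%:Z - r%:Z) * ipoch (r%:Z + c%:Z)))).
    by rewrite expD; ring.
  (* This regrouping confines r to (B - r)(s - r), the exponent summed by [inner]. *)
  have -> : (s%:Z - r%:Z) * (B%:Z + c%:Z + s%:Z) + r%:Z * (r%:Z + c%:Z) =
    s%:Z * (s%:Z + c%:Z) + (B%:Z - r%:Z) * (s%:Z - r%:Z) by ring.
  by rewrite expD; ring.
rewrite exchange_big /=.
transitivity (qpoch q q (A + B) * qpoch q q (B + M + c) / qpoch q q B * ipoch (B%:Z + c%:Z) *
   \sum_(s < M.+1) q ^ (s%:Z * (s%:Z + c%:Z)) * (ipoch (s%:Z + c%:Z) * ipoch (A%:Z - s%:Z - c%:Z)
                * ipoch s%:Z * ipoch (M%:Z - s%:Z))).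
  rewrite mulr_sumr; apply: eq_bigr => s _; have sM : (s <= M)%N by have := ltn_ord s; lia.
  rewrite -!mulr_sumr inner //.
  have -> : B%:Z + c%:Z + s%:Z = (B + (s + c))%N by lia.
  have -> : s%:Z + c%:Z = (s + c)%N by lia.
  rewrite /(ipoch (Posz (B + (s+c)))) /(ipoch (Posz (s + c))); field.
  by rewrite !qpoch_neq0.
rewrite qvandermonde; last by rewrite ltnSn.
by field; rewrite !qpoch_neq0.
Qed.

(** * The Burge transform *)

Lemma sum_ord_split (F : nat -> C) (m n : nat) : (m <= n)%N ->
  \sum_(i < n) F i = \sum_(i < m) F i + \sum_(i < n - m) F (m + i)%N.
Proof. by move=> mn; rewrite -[in LHS](subnKC mn) big_split_ord. Qed.

Lemma sum_ord_widen (F : nat -> C) (n m : nat) : (n <= m)%N ->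
  (forall i, (n <= i)%N -> F i = 0) -> \sum_(i < m) F i = \sum_(i < n) F i.
Proof.
move=> /subnKC <- F0; rewrite big_split_ord /= [X in _ + X]big1 ?addr0 // => i _.
by rewrite F0 // leq_addr.
Qed.

(** A product of two q-binomials. Each top index is the sum of its two bottom ones, so when it is
    negative an [ipoch] factor is zero and [absz] is harmless. *)
Definition burgeT (L M : nat) (a b : int) : C :=
  qpoch q q (absz ((L + M)%:Z + a - b)%R) * qpoch q q (absz ((L + M)%:Z - a + b)%R) *
  (ipoch (L%:Z + a) * ipoch (M%:Z - b) * ipoch (L%:Z - a) * ipoch (M%:Z + b)).

Lemma burgeTN L M a b : burgeT L M (- a) (- b) = burgeT L M a b.
Proof. by rewrite /burgeT !opprK [X in X * _]mulrC; ring. Qed.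

(** The numerators of T(i,L-i,b,a) have indices L + b - a and L - b + a, free of i, and come out of
    the sum. With i = b + r the rest is the q-Saalschuetz sum with c = 2b. *)
Lemma burge_transform_nat (L M a b : nat) :
  \sum_(i < L.+1) q ^ (i%:Z * i%:Z) * (qpoch q q (L + L + M - i) * ipoch (L + L)%:Z
      * ipoch (M%:Z - i%:Z)) * burgeT i (L - i) b a =
  q ^ (b%:Z * b%:Z) * burgeT L M (a%:Z + b%:Z) b.
Proof.
have [Lab|Lab] := ltnP L (a + b).
  rewrite /burgeT (ipoch_lt0 (_ - (a%:Z + b%:Z))) ?(mulr0, mul0r); last lia.
  rewrite big1 // => i _; have [ib|ib] := ltnP i b.
    by rewrite (ipoch_lt0 (i%:Z - b%:Z)) ?(mulr0, mul0r) //; lia.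
  by rewrite (ipoch_lt0 (_ - a%:Z)) ?(mulr0, mul0r) //; have := ltn_ord i; lia.
have [Mb|Mb] := ltnP M b.
  rewrite /burgeT (ipoch_lt0 (M%:Z - _)) ?(mulr0, mul0r); last lia.
  rewrite big1 // => i _; have [ib|ib] := ltnP i b.
    by rewrite (ipoch_lt0 (i%:Z - b%:Z)) ?(mulr0, mul0r) //; lia.
  by rewrite (ipoch_lt0 (M%:Z - i%:Z)) ?(mulr0, mul0r) //; have := ltn_ord i; lia.
pose A := (L + b - a)%N; pose B := (L + a - b)%N; pose N := (M - b)%N; pose c := (b + b)%N.
pose F (i : nat) := q ^ (i%:Z * i%:Z) * (qpoch q q (L + L + M - i) * ipoch (M%:Z - i%:Z)
   * (ipoch (L%:Z - i%:Z - a%:Z) * ipoch (L%:Z - i%:Z + a%:Z) * ipoch (i%:Z + b%:Z) * ipoch (i%:Z - b%:Z))).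
transitivity (qpoch q q A * qpoch q q B * ipoch (L + L)%:Z * \sum_(i < L.+1) F i).
  rewrite mulr_sumr; apply: eq_bigr => i _; rewrite /F /burgeT.
  have iL := ltn_ord i.
  have -> : absz ((i + (L - i))%:Z + b%:Z - a%:Z)%R = (A)%N by lia.
  have -> : absz ((i + (L - i))%:Z - b%:Z + a%:Z)%R = (B)%N by lia.
  have -> : (L - i)%:Z = L%:Z - i%:Z by lia.
  by ring.
(* The terms vanish both for i > L and for i > M, so the range can pass from L + 1 through L + M + 1
   to M + 1. *)
rewrite -(@sum_ord_widen F L.+1 (L + M).+1); [|lia|]; last first.
  by move=> i Li; rewrite /F (ipoch_lt0 (_ - a%:Z)) ?(mulr0, mul0r) //; lia.
rewrite (@sum_ord_widen F M.+1); [|lia|]; last first.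
  by move=> i Li; rewrite /F (ipoch_lt0 (M%:Z - _)) ?(mulr0, mul0r) //; lia.
have -> : M.+1 = (b + N.+1)%N by lia.
rewrite big_split_ord /= big1 => [|i _]; last first.
  by rewrite /F (ipoch_lt0 (_ - b%:Z)) ?(mulr0, mul0r) //; have := ltn_ord i; lia.
rewrite add0r.
transitivity (qpoch q q A * qpoch q q B * ipoch (L + L)%:Z * (q ^ (b%:Z * b%:Z) *
  \sum_(r < N.+1) q ^ (r%:Z * (r%:Z + c%:Z)) * (qpoch q q (A + B + N - r) * ipoch (N%:Z - r%:Z)
     * (ipoch (A%:Z - r%:Z - c%:Z) * ipoch (B%:Z - r%:Z) * ipoch (r%:Z + c%:Z) * ipoch r%:Z)))).
  congr (_ * _); rewrite mulr_sumr; apply: eq_bigr => r _; rewrite /F [RHS]mulrA -expD.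
  have rN := ltn_ord r.
  have -> : (L + L + M - (b + r) = A + B + N - r)%N by lia.
  have -> : M%:Z - (b + r)%N%:Z = N%:Z - r%:Z by lia.
  have -> : L%:Z - (b + r)%N%:Z - a%:Z = A%:Z - r%:Z - c%:Z by lia.
  have -> : L%:Z - (b + r)%N%:Z + a%:Z = B%:Z - r%:Z by lia.
  have -> : (b + r)%N%:Z + b%:Z = r%:Z + c%:Z by lia.
  have -> : (b + r)%N%:Z - b%:Z = r%:Z by lia.
  by congr (q ^ _ * _); rewrite /c !PoszD; ring.
rewrite qsaalschutz /burgeT.
have -> : (A + B = L + L)%N by lia.
have -> : absz ((L + M)%:Z + (a%:Z + b%:Z) - b%:Z)%R = (B + N + c)%N by lia.
have -> : absz ((L + M)%:Z - (a%:Z + b%:Z) + b%:Z)%R = (A + N)%N by lia.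
have -> : N%:Z + c%:Z = M%:Z + b%:Z by lia.
have -> : A%:Z - c%:Z = L%:Z - (a%:Z + b%:Z) by lia.
have -> : B%:Z + c%:Z = L%:Z + (a%:Z + b%:Z) by lia.
have -> : M%:Z - b%:Z = N by lia.
rewrite /(ipoch (Posz (L + L))) /(ipoch (Posz N)); field.
by rewrite !qpoch_neq0.
Qed.

(** The limit M -> oo of [burge_transform_nat], multiplied by (q)_(2L); here q-Vandermonde takes the
    place of q-Saalschuetz. *)
Lemma burge_transform_inf_nat (L a b : nat) :
  \sum_(i < L.+1) q ^ (i%:Z * i%:Z) * burgeT i (L - i) b a =
  q ^ (b%:Z * b%:Z) * (qpoch q q (L + L) * ipoch (L%:Z + (a%:Z + b%:Z)) * ipoch (L%:Z - (a%:Z + b%:Z))).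
Proof.
have [Lab|Lab] := ltnP L (a + b).
  rewrite /burgeT (ipoch_lt0 (_ - (a%:Z + b%:Z))) ?(mulr0, mul0r); last lia.
  rewrite big1 // => i _; have [ib|ib] := ltnP i b.
    by rewrite (ipoch_lt0 (i%:Z - b%:Z)) ?(mulr0, mul0r) //; lia.
  by rewrite (ipoch_lt0 (_ - a%:Z)) ?(mulr0, mul0r) //; have := ltn_ord i; lia.
pose A := (L + b - a)%N; pose B := (L + a - b)%N; pose c := (b + b)%N.
have -> : L.+1 = (b + (L - b).+1)%N by lia.
rewrite big_split_ord /= big1 => [|i _]; last first.
  by rewrite /burgeT (ipoch_lt0 (i%:Z - b%:Z)) ?(mulr0, mul0r) //; have := ltn_ord i; lia.
rewrite add0r.
transitivity (qpoch q q A * qpoch q q B * (q ^ (b%:Z * b%:Z) *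
  \sum_(r < (L - b).+1) q ^ (r%:Z * (r%:Z + c%:Z)) * (ipoch (r%:Z + c%:Z) * ipoch (A%:Z - r%:Z - c%:Z)
                * ipoch r%:Z * ipoch (B%:Z - r%:Z)))).
  rewrite !mulr_sumr; apply: eq_bigr => r _; rewrite /burgeT.
  have rL := ltn_ord r.
  have -> : absz (((b + r) + (L - (b + r)))%:Z + b%:Z - a%:Z)%R = (A)%N by lia.
  have -> : absz (((b + r) + (L - (b + r)))%:Z - b%:Z + a%:Z)%R = (B)%N by lia.
  have -> : (b + r)%N%:Z + b%:Z = r%:Z + c%:Z by lia.
  have -> : (b + r)%N%:Z - b%:Z = r%:Z by lia.
  have -> : (L - (b + r))%:Z - a%:Z = A%:Z - r%:Z - c%:Z by lia.
  have -> : (L - (b + r))%:Z + a%:Z = B%:Z - r%:Z by lia.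
  have -> : (b + r)%:Z * (b + r)%:Z = b%:Z * b%:Z + r%:Z * (r%:Z + c%:Z) by rewrite /c !PoszD; ring.
  by rewrite expD; ring.
rewrite qvandermonde; last by apply/orP; right; lia.
have -> : (A + B = L + L)%N by lia.
have -> : B%:Z + c%:Z = L%:Z + (a%:Z + b%:Z) by lia.
have -> : A%:Z - c%:Z = L%:Z - (a%:Z + b%:Z) by lia.
by field; rewrite !qpoch_neq0.
Qed.

(** As both arguments are multiples of the same j, [burgeTN] reduces j < 0 to the natural case. For
    consecutive Fibonacci numbers g and f, the new factor g + f is the next one. *)
Lemma burge_transform (L M f g : nat) (j : int) :
  \sum_(i < L.+1) q ^ (i%:Z * i%:Z) * (qpoch q q (L + L + M - i) * ipoch (L + L)%:Z
      * ipoch (M%:Z - i%:Z)) * burgeT i (L - i) (g%:Z * j) (f%:Z * j) =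
  q ^ ((g%:Z * j) * (g%:Z * j)) * burgeT L M ((g + f)%:Z * j) (g%:Z * j).
Proof.
have -> : (g + f)%:Z * j = f%:Z * j + g%:Z * j by rewrite PoszD; ring.
case: (intP j) => [|n|n].
- by rewrite !mulr0; exact: (burge_transform_nat L M 0 0).
- by rewrite -!PoszM; exact: burge_transform_nat.
rewrite !(mulrN, mulNr, opprK) -opprD burgeTN -!PoszM -burge_transform_nat.
by apply: eq_bigr => i _; rewrite burgeTN.
Qed.

Lemma burge_transform_inf (L f g : nat) (j : int) :
  \sum_(i < L.+1) q ^ (i%:Z * i%:Z) * burgeT i (L - i) (g%:Z * j) (f%:Z * j) =
  q ^ ((g%:Z * j) * (g%:Z * j)) *
  (qpoch q q (L + L) * ipoch (L%:Z + (g + f)%:Z * j) * ipoch (L%:Z - (g + f)%:Z * j)).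
Proof.
have -> : (g + f)%:Z * j = f%:Z * j + g%:Z * j by rewrite PoszD; ring.
case: (intP j) => [|n|n].
- by rewrite !mulr0; exact: (burge_transform_inf_nat L 0 0).
- by rewrite -!PoszM; exact: burge_transform_inf_nat.
transitivity (\sum_(i < L.+1) q ^ (i%:Z * i%:Z) * burgeT i (L - i) (g * n.+1)%:Z (f * n.+1)%:Z).
  by apply: eq_bigr => i _; rewrite !mulrN burgeTN -!PoszM.
by rewrite burge_transform_inf_nat !(mulrN, mulNr, opprK) -!PoszM -opprD opprK; ring.
Qed.

(** * Symmetric sums over |j| <= n: q-Kummer, finite triple product, Bailey lemma *)

Lemma expN a : q ^ (- a) = (q ^ a)^-1.
Proof. by rewrite -invr_expz. Qed.

Definition zsum (n : nat) (F : int -> C) : C :=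
  F 0 + \sum_(i < n) (F i.+1%:Z + F (- i.+1%:Z)).

Lemma zsumS n F : zsum n.+1 F = zsum n F + (F n.+1%:Z + F (- n.+1%:Z)).
Proof. by rewrite /zsum big_ord_recr addrA. Qed.

Lemma eq_zsum n F G : (forall j, F j = G j) -> zsum n F = zsum n G.
Proof. by move=> FG; rewrite /zsum FG; congr (_ + _); apply: eq_bigr => i _; rewrite !FG. Qed.

Lemma zsumD n F G : zsum n (fun j => F j + G j) = zsum n F + zsum n G.
Proof. by elim: n => [|n IH]; rewrite ?zsumS ?IH /zsum ?big_ord0; ring. Qed.

Lemma mulr_zsumr n a F : a * zsum n F = zsum n (fun j => a * F j).
Proof. by elim: n => [|n IH]; rewrite ?zsumS -?IH /zsum ?big_ord0; ring. Qed.

Lemma zsum_sum n m (F : 'I_m -> int -> C) :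
  \sum_(i < m) zsum n (F i) = zsum n (fun j => \sum_(i < m) F i j).
Proof.
by rewrite /zsum big_split exchange_big; congr (_ + _); apply: eq_bigr => i _; rewrite big_split.
Qed.

Lemma zsum_opp n F : zsum n (fun j => F (- j)) = zsum n F.
Proof.
by rewrite /zsum oppr0; congr (_ + _); apply: eq_bigr => i _; rewrite opprK addrC.
Qed.

Lemma zsum_shift n F : zsum n (fun j => F (j + 1)) = zsum n F + F n.+1%:Z - F (- n%:Z).
Proof.
elim: n => [|n IH]; first by rewrite /zsum !big_ord0 add0r oppr0; ring.
rewrite !zsumS IH.
have -> : n.+1%:Z + 1 = n.+2 by lia.
have -> : - n.+1%:Z + 1 = - n%:Z by lia.
ring.
Qed.

Lemma zsum_pred n F : zsum n (fun j => F (j - 1)) = zsum n F + F (- n.+1%:Z) - F n%:Z.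
Proof.
rewrite -[LHS]zsum_opp -[in RHS](zsum_opp n F).
rewrite (@eq_zsum n _ (fun j => F (- (j + 1)))); last by move=> j; congr F; ring.
by rewrite (zsum_shift n (fun j => F (- j))) opprK.
Qed.

Lemma zsum_widen n m F : (n <= m)%N -> (forall j, (n < absz j)%N -> F j = 0) ->
  zsum m F = zsum n F.
Proof.
move=> cmod F0; rewrite /zsum (@sum_ord_widen (fun i => F i.+1%:Z + F (- i.+1%:Z)) n) // => i ni.
by rewrite !F0 ?addr0 //; lia.
Qed.

Definition alt (j : int) : C := (-1) ^ j.

Lemma altS j : alt (j + 1) = - alt j.
Proof. by rewrite /alt expfzDr ?oppr_eq0 ?oner_neq0 // expr1z mulrN1. Qed.

Lemma altN j : alt (- j) = alt j.
Proof. by rewrite /alt -exprz_inv invrN invr1. Qed.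

Definition qsign (j : int) : C := alt j * q ^ tri j.

Lemma qsignS j : qsign (j + 1) = - (q ^ j * qsign j).
Proof. by rewrite /qsign altS triS expD; ring. Qed.

Lemma qsignN j : qsign (- j) = q ^ j * qsign j.
Proof.
rewrite /qsign altN mulrCA -expD; congr (_ * q ^ _).
by have := tri2 j; have := tri2 (- j); nia.
Qed.

(* Terminating q-Kummer sum.  Symmetrising under j -> -j gives the summand
   (1 + q^j) * qsign j * w u j, for which the recurrence in u telescopes. *)
Lemma qkummer (u v : nat) (n : nat) : (u <= n)%N ->
  zsum n (fun j => q ^ j * qsign j *
    (ipoch (u%:Z + j) * ipoch (u%:Z - j) * ipoch (v%:Z + j) * ipoch (v%:Z - j)))
  = q ^ (u%:Z * v%:Z) * (ipoch u%:Z * ipoch v%:Z * ipoch (u%:Z + v%:Z)).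
Proof.
pose w (u : nat) j := ipoch (u%:Z + j) * ipoch (u%:Z - j) * ipoch (v%:Z + j) * ipoch (v%:Z - j).
pose f u := zsum n (fun j => q ^ j * qsign j * w u j).
rewrite -/(f u).
elim: u => [|u IH] un.
  rewrite /f (@zsum_widen 0) // => [|j j0]; last first.
    rewrite /w; have [j1|j1] := ltP j 0.
      by rewrite (ipoch_lt0 (0%:Z + _)) ?(mul0r, mulr0) //; lia.
    by rewrite (ipoch_lt0 (0%:Z - _)) ?(mul0r, mulr0) //; lia.
  rewrite /zsum big_ord0 /w /qsign /alt !addr0 ?subr0 ipoch0 mul0r add0r.
  by rewrite (_ : tri 0 = 0) // !expr0z ?divr1 !mulr1.
have sym u' : f u' + f u' = zsum n (fun j => qsign j * (1 + q ^ j) * w u' j).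
  rewrite {2}/f -zsum_opp -zsumD; apply: eq_zsum => j.
  have -> : w u' (- j) = w u' j by rewrite /w opprK; ring.
  by rewrite qsignN mulrA -expD addNr expr0z; ring.
have two : (1 + 1 : C) != 0 by rewrite -(natrD _ 1 1) pnatr_eq0.
have hu : 1 - q ^ u.+1%:Z != 0 by rewrite -exprnP subr_eq0 eq_sym.
have huv : 1 - q ^ (u.+1%:Z + v%:Z) != 0 by rewrite -PoszD addSn -exprnP subr_eq0 eq_sym.
(* A telescoping certificate for [rec]: termwise, the two sides differ by G j - G (j+1). Both
   boundary values vanish because u < n. *)
pose G j := qsign j * (ipoch (u.+1%:Z + j - 1) * ipoch (u.+1%:Z - j) * ipoch (v%:Z + j - 1) * ipoch (v%:Z - j)).
have rec : (1 - q ^ u.+1%:Z) * (1 - q ^ (u.+1%:Z + v%:Z)) * (f u.+1 + f u.+1) = q ^ v%:Z * (f u + f u).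
  rewrite !sym !mulr_zsumr.
  apply/eqP; rewrite -subr_eq0 -[- zsum _ _]mulN1r mulr_zsumr -zsumD; apply/eqP.
  transitivity (zsum n (fun j => G j + - 1 * G (j + 1))).
    apply: eq_zsum => j; rewrite /G /w qsignS.
    have -> : u%:Z + j = u.+1%:Z + j - 1 by lia.
    have -> : u%:Z - j = u.+1%:Z - j - 1 by lia.
    have -> : u.+1%:Z + (j + 1) - 1 = u.+1%:Z + j by lia.
    have -> : u.+1%:Z - (j + 1) = u.+1%:Z - j - 1 by lia.
    have -> : v%:Z + (j + 1) - 1 = v%:Z + j by lia.
    have -> : v%:Z - (j + 1) = v%:Z - j - 1 by lia.
    rewrite -!ipochP !expD expN; field.
    by rewrite expfz_neq0.
  rewrite zsumD -mulr_zsumr zsum_shift /G.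
  rewrite (ipoch_lt0 (u.+1%:Z - n.+1%:Z)) ?(mul0r, mulr0); last lia.
  rewrite (ipoch_lt0 (u.+1%:Z + - n%:Z - 1)) ?(mul0r, mulr0); last lia.
  ring.
have {}IH := IH (ltnW un).
apply: (mulfI two); apply: (mulfI huv); apply: (mulfI hu).
transitivity (q ^ v%:Z * (f u + f u)); first by rewrite -rec; ring.
rewrite IH.
have -> : u%:Z = u.+1%:Z - 1 by lia.
have -> : u.+1%:Z - 1 + v%:Z = u.+1%:Z + v%:Z - 1 by lia.
rewrite -!ipochP.
have -> : u.+1%:Z * v%:Z = (u.+1%:Z - 1) * v%:Z + v%:Z by ring.
by rewrite (expD (_ * _)); ring.
Qed.

(** Induction on n: the new factor (1 - z q^n)(1 - q^(n+1)/z) has the terms 1 + q^(2n+1), -z q^n and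
    -q^(n+1)/z, and the powers of z are absorbed by moving j to j - 1 and j + 1. *)
Lemma finite_jacobi_triple (z : C) (n : nat) : z != 0 ->
  zsum n (fun j => qsign j * z ^ j * (ipoch (n%:Z - j) * ipoch (n%:Z + j))) =
  qpoch z q n * qpoch (q / z) q n / qpoch q q n.*2.
Proof.
move=> z0; elim: n => [|n IH].
  by rewrite /zsum big_ord0 !qpoch0 subr0 addr0 ipoch0 /qsign /alt (_ : tri 0 = 0) // !expr0z ?divr1 !mulr1.
have h1 : 1 - q ^ n.*2.+1%:Z != 0 by rewrite -exprnP subr_eq0 eq_sym.
have h2 : 1 - q ^ n.*2.+2%:Z != 0 by rewrite -exprnP subr_eq0 eq_sym.
pose X := qsign.
pose s (j : int) := qsign j * z ^ j.
pose t (j : int) := s j * (ipoch (n%:Z - j) * ipoch (n%:Z + j)).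
have zS j : z ^ (j + 1) = z ^ j * z by rewrite expfzDr.
apply: (mulfI h1); apply: (mulfI h2).
transitivity ((1 - z * q ^ n%:Z) * (1 - q ^ n.+1%:Z / z) * zsum n t); last first.
  by rewrite IH doubleS !qpochS -!exprS !exprnP !exprSz; field; rewrite ?z0 -!exprSz ?h1 ?h2 ?qpoch_neq0.
(* Adding the zero terms at |j| = n + 1 makes the boundary terms of both index shifts vanish. *)
rewrite -(@zsum_widen n n.+1 t) //; last first.
  move=> j nj; rewrite /t; have [j0|j0] := ltP j 0.
    by rewrite (ipoch_lt0 (n%:Z + j)) ?mulr0 //; lia.
  by rewrite (ipoch_lt0 (n%:Z - j)) ?mul0r ?mulr0 //; lia.
transitivity (zsum n.+1 (fun j => (1 + q ^ n.*2.+1%:Z) * t j + (- z * q ^ n%:Z) * t (j - 1)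
   + (- q ^ n.+1%:Z / z) * t (j + 1))); last first.
  rewrite !zsumD -!mulr_zsumr (zsum_shift _ t) (zsum_pred _ t) /t.
  rewrite (ipoch_lt0 (n%:Z - n.+2%:Z)) ?(ipoch_lt0 (n%:Z + - n.+1%:Z)); try lia.
  have -> : q ^ n.*2.+1%:Z = q ^ n%:Z * q ^ n.+1%:Z by rewrite -expD; congr (q ^ _); lia.
  by field.
rewrite !mulr_zsumr; apply: eq_zsum => j; rewrite /t /s.
have -> : n%:Z - (j - 1) = n.+1%:Z - j by lia.
have -> : n%:Z + (j - 1) = n.+1%:Z + j - 1 - 1 by lia.
have -> : n%:Z - (j + 1) = n.+1%:Z - j - 1 - 1 by lia.
have -> : n%:Z + (j + 1) = n.+1%:Z + j by lia.
have -> : n%:Z - j = n.+1%:Z - j - 1 by lia.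
have -> : n%:Z + j = n.+1%:Z + j - 1 by lia.
have Eb : - z * (qsign (j - 1) * z ^ (j - 1)) = (q ^ j)^-1 * q * (qsign j * z ^ j).
  have := qsignS (j - 1); have := zS (j - 1); rewrite !subrK => -> ->.
  rewrite expD expN; field.
  by rewrite q_neq0 expfz_neq0.
have Ef : - (qsign (j + 1) * z ^ (j + 1)) / z = q ^ j * (qsign j * z ^ j).
  by rewrite qsignS zS; field.
rewrite -!ipochP.
transitivity ((1 + q ^ n.*2.+1) * (qsign j * z ^ j * ((1 - q ^ (n.+1%:Z - j)) * ipoch (n.+1%:Z - j) * ((1 - q ^ (n.+1%:Z + j)) * ipoch (n.+1%:Z + j))))
  + q ^ n%:Z * ((q ^ j)^-1 * q * (qsign j * z ^ j)) * (ipoch (n.+1%:Z - j) * ((1 - q ^ (n.+1%:Z + j - 1)) * ((1 - q ^ (n.+1%:Z + j)) * ipoch (n.+1%:Z + j))))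
  + q ^ n.+1%:Z * (q ^ j * (qsign j * z ^ j)) * ((1 - q ^ (n.+1%:Z - j - 1)) * ((1 - q ^ (n.+1%:Z - j)) * ipoch (n.+1%:Z - j)) * ipoch (n.+1%:Z + j))); last first.
  by rewrite -Eb -Ef; ring.
rewrite !expD !expN !exprSz -addnn PoszD expD ?expr1z.
by field; rewrite q_neq0 expfz_neq0.
Qed.

(** The Bailey lemma at a = 1 with both free parameters at infinity, for a single pair of
    denominators. Both sides are even in v, and l = |v| + r turns the sum into
    [qvandermonde_inf]. *)
Lemma bailey_lemma (N : nat) (v : int) :
  \sum_(l < N.+1) q ^ (l%:Z * l%:Z) * ipoch (N%:Z - l%:Z) * (ipoch (l%:Z - v) * ipoch (l%:Z + v)) =
  q ^ (v * v) * (ipoch (N%:Z - v) * ipoch (N%:Z + v)).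
Proof.
wlog [m ->] : v / exists m : nat, v = m.
  move=> H; have [v0|v0] := leP 0 v; first by apply: H; exists `|v|%N; lia.
  have := H (- v); rewrite mulrNN !opprK => {}H.
  rewrite [ipoch (N%:Z - v) * _]mulrC -H; last by exists `|v|%N; lia.
  by apply: eq_bigr => l _; congr (_ * _); rewrite mulrC.
have [Nm|mN] := ltnP N m.
  rewrite (ipoch_lt0 (N%:Z - m%:Z)) ?(mul0r, mulr0); last lia.
  rewrite big1 // => l _; rewrite (ipoch_lt0 (l%:Z - m%:Z)) ?(mul0r, mulr0) //.
  by have := ltn_ord l; lia.
have -> : N.+1 = (m + (N - m).+1)%N by lia.
rewrite big_split_ord /= big1 => [|l _]; last first.
  by rewrite (ipoch_lt0 (_ - m%:Z)) ?(mul0r, mulr0) //; have := ltn_ord l; lia.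
have -> : N%:Z - m%:Z = (N - m)%N by lia.
have -> : N%:Z + m%:Z = (N - m)%:Z + (m + m)%:Z by lia.
rewrite add0r -(@qvandermonde_inf _ _ (N - m).+1) // mulr_sumr; apply: eq_bigr => r _.
have -> : N%:Z - (m + r)%:Z = (N - m)%:Z - r%:Z by lia.
have -> : (m + r)%:Z - m%:Z = r by lia.
have -> : (m + r)%:Z + m%:Z = r%:Z + (m + m)%:Z by lia.
have -> : (m + r)%:Z * (m + r)%:Z = m%:Z * m%:Z + r%:Z * (r%:Z + (m + m)%:Z).
  by rewrite !PoszD; ring.
by rewrite expD; ring.
Qed.

End FiniteIdentities.

(** * The multisum as an iterated Burge transform *)

Section Tree.
Variables (C : numFieldType) (q : C).

(* The sum over the last variables of the multisum, as a function of
   L = m_j and M = m_(j-1) - m_j *)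
Fixpoint burge_tree (n L M : nat) : C :=
  if n is n'.+1 then
    \sum_(i < L.+1) q ^+ (i ^ 2) * qbinom q ((L + L + M)%:Z - i%:Z) (L + L)%:Z
      * burge_tree n' i (L - i)
  else q ^+ (L * M) * qbinom q (L + M)%:Z L%:Z.

(** The sum over m_3, ..., m_(k-2) for l = m_2 and k = n + 5. At this level the binomial of
    [burge_tree] is replaced by its limit M -> oo, the factor 1/(q)_(2 m_2), which is kept
    outside. *)
Definition burge_root (n l : nat) : C :=
  \sum_(x < l.+1) q ^+ (x ^ 2) * burge_tree n x (l - x).

Lemma eq_box_sum d N (F G : seq nat -> C) : (forall s, size s = d -> F s = G s) ->
  box_sum d N F = box_sum d N G.
Proof.
elim: d F G => [|d IH] F G FG; first exact: FG.
by apply: eq_bigr => i _; apply: IH => s sd; apply: FG; rewrite /= sd.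
Qed.

Lemma box_sumZ d N a (F : seq nat -> C) :
  box_sum d N (fun s => a * F s) = a * box_sum d N F.
Proof.
elim: d F => [|d IH] F //=; rewrite mulr_sumr; apply: eq_bigr => i _; exact: IH.
Qed.

(** The factors of the summand that involve m_3, ..., m_(k-2), with l = m_2, arranged so that
    variables can be summed one at a time. *)
Fixpoint tail_summand (l : nat) (s : seq nat) : C :=
  match s with
  | [::] => 1
  | x :: s' =>
    match s' with
    | [::] => q ^+ (l * x) * qbinom q l%:Z x%:Z
    | y :: _ => q ^+ (x ^ 2) * qbinom q (l%:Z + x%:Z - y%:Z) (2 * x)%N%:Z * tail_summand x s'
    end
  end.

Lemma tail_summand_cons l x y s : tail_summand l [:: x, y & s] =
  q ^+ (x ^ 2) * qbinom q (l%:Z + x%:Z - y%:Z) (2 * x)%N%:Z * tail_summand x (y :: s).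
Proof. by []. Qed.

Lemma tail_summandE n l s : size s = n.+1 -> tail_summand l s =
  q ^+ (\sum_(i < n) (nth 0%N s i) ^ 2 + nth 0%N (l :: s) n * nth 0%N s n) *
  \prod_(i < n) qbinom q ((nth 0%N (l :: s) i)%:Z + (nth 0%N s i)%:Z - (nth 0%N s i.+1)%:Z)
     (2 * nth 0%N s i)%N%:Z * qbinom q (nth 0%N (l :: s) n)%:Z (nth 0%N s n)%:Z.
Proof.
elim: n l s => [|n IH] l [|x [|y s]] // sn.
  by rewrite /= !big_ord0 mulr1 add0n.
rewrite tail_summand_cons (IH x (y :: s)); last by case: sn => /= ->.
rewrite !big_ord_recl /= -!addnA !exprD.
under [in RHS]eq_bigr do rewrite add0n.
under [X in _ = _ * (_ * X) * _]eq_bigr do rewrite add0n.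
ring.
Qed.

Lemma summandE n m1 m2 s : size s = n.+1 -> summand (n + 5) q [:: m1, m2 & s] =
  q ^+ ((m1 + m2) ^ 2 + m2 ^ 2)%N / (qpoch q q m1 * qpoch q q (2 * m2)) * tail_summand m2 s.
Proof.
move=> sn; rewrite /summand (tail_summandE _ _ _ sn).
have -> : (n + 5 - 2 = n.+1.+2)%N by lia.
have -> : (n + 5 - 3 = n.+2)%N by lia.
have shift3 (T : Type) (idx : T) op (F : nat -> T) :
    \big[op/idx]_(3 <= j < n.+3) F j = \big[op/idx]_(i < n) F i.+3.
  transitivity (\big[op/idx]_(0 <= i < n.+3 - 3) F (i + 3)%N).
    exact: (big_addn 0 n.+3 3 xpredT F).
  by rewrite !subSS subn0 big_mkord; apply: eq_bigr => i _; rewrite addn3.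
rewrite big_ltn // !shift3 /= -!addnA !exprD; ring.
Qed.

(** A binomial with y > l vanishes, so the variables decrease from m_2 on, and once y < N the box no
    longer truncates the inner sums. The base case uses l y = y^2 + y (l - y). *)
Lemma box_tail_summand n N l y : (y < N)%N ->
  box_sum n N (fun s => tail_summand l (y :: s)) =
  if (y <= l)%N then q ^+ (y ^ 2) * burge_tree n y (l - y) else 0.
Proof.
elim: n l y => [|n IH] l y yN.
  rewrite /=; case: leqP => [yl|ly]; last by rewrite /qbinom lez_nat leqNgt ly /= mulr0.
  by rewrite mulrA -exprD subnKC // -mulnn -mulnDr subnKC // mulnC.
transitivity (\sum_(z < N) q ^+ (y ^ 2) * qbinom q (l%:Z + y%:Z - z%:Z) (2 * y)%N%:Z *
   box_sum n N (fun s => tail_summand y (nat_of_ord z :: s))).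
  by rewrite [LHS]/=; apply: eq_bigr => z _; rewrite -box_sumZ.
rewrite (eq_bigr (fun z : 'I_N => q ^+ (y ^ 2) * qbinom q (l%:Z + y%:Z - z%:Z) (2 * y)%N%:Z *
   (if (z <= y)%N then q ^+ (z ^ 2) * burge_tree n z (y - z) else 0))); last first.
  by move=> z _; rewrite IH.
case: leqP => [yl|ly]; last first.
  by apply: big1 => z _; rewrite /qbinom ifF ?mulr0 ?mul0r //; apply/negbTE; lia.
pose F (z : nat) := q ^+ (y ^ 2) * qbinom q (l%:Z + y%:Z - z%:Z) (2 * y)%N%:Z *
   (if (z <= y)%N then q ^+ (z ^ 2) * burge_tree n z (y - z) else 0).
rewrite (@sum_ord_widen C F y.+1) //; last by move=> i yi; rewrite /F leqNgt yi mulr0.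
rewrite /= mulr_sumr; apply: eq_bigr => z _; rewrite /F -ltnS ltn_ord.
have -> : (y + y + (l - y))%:Z = l%:Z + y%:Z by lia.
by rewrite mul2n addnn; ring.
Qed.

Lemma box_sum_summand n N : box_sum (n + 5 - 2) N (summand (n + 5) q) =
  \sum_(m1 < N) \sum_(m2 < N) q ^+ ((m1 + m2) ^ 2 + m2 ^ 2)%N
     / (qpoch q q m1 * qpoch q q (2 * m2)) * burge_root n m2.
Proof.
have -> : (n + 5 - 2 = n.+3)%N by lia.
rewrite [LHS]/=; apply: eq_bigr => m1 _; apply: eq_bigr => m2 _.
rewrite -[LHS]/(box_sum n.+1 N (fun s => summand (n + 5) q [:: nat_of_ord m1, nat_of_ord m2 & s])).
rewrite (eq_box_sum _ _ _ (fun s => q ^+ ((m1 + m2) ^ 2 + m2 ^ 2)%N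
     / (qpoch q q m1 * qpoch q q (2 * m2)) * tail_summand m2 s)); last first.
  by move=> s sn; rewrite summandE.
rewrite box_sumZ; congr (_ * _).
rewrite [LHS]/= (eq_bigr (fun y : 'I_N => if (y <= m2)%N then q ^+ (y ^ 2) * burge_tree n y (m2 - y) else 0)); last first.
  by move=> y _; rewrite box_tail_summand.
rewrite /burge_root (@sum_ord_widen C (fun y => if (y <= m2)%N then q ^+ (y ^ 2) * burge_tree n y (m2 - y) else 0) m2.+1) //.
  by apply: eq_bigr => y _; rewrite -ltnS ltn_ord.
by move=> i mi; rewrite leqNgt mi.
Qed.

Hypotheses (q_neq1 : forall n, q ^+ n.+1 != 1) (q_neq0 : q != 0).
Local Notation ipoch := (@ipoch C q).
Local Notation zsum := (@zsum C).
Local Notation qsign := (@qsign C q).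
Local Notation burgeT := (@burgeT C q).

(** F_(n+1) F_(n+2) - 1 is the sum of F_i^2 over 2 <= i <= n + 1, one square for each transform
    performed; it is 0 at n = 0. *)
Definition tree_coef (n : nat) (j : int) : C :=
  q ^ j * qsign j * q ^ ((fib n.+1 * fib n.+2 - 1)%:Z * (j * j)).

Lemma tree_coefS n j :
  tree_coef n j * q ^ (((fib n.+2)%:Z * j) * ((fib n.+2)%:Z * j)) = tree_coef n.+1 j.
Proof.
rewrite /tree_coef -[LHS]mulrA -expD //; congr (_ * q ^ _).
have -> : (fib n.+2 * fib n.+3 - 1 = (fib n.+1 * fib n.+2 - 1) + fib n.+2 * fib n.+2)%N.
  rewrite (fibSS n.+1) mulnDr; have := fib_gt0 n; have := fib_gt0 n.+1; nia.
by rewrite PoszD PoszM; ring.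
Qed.

Lemma burge_treeE n L M : burge_tree n L M =
  zsum L (fun j => tree_coef n j * burgeT L M ((fib n.+2)%:Z * j) ((fib n.+1)%:Z * j)).
Proof.
elim: n L M => [|n IH] L M.
  rewrite /= (eq_zsum _ _ _ (fun j => qpoch q q (L + M) * qpoch q q (L + M) * (q ^ j * qsign j *
    (ipoch (L%:Z + j) * ipoch (L%:Z - j) * ipoch (M%:Z + j) * ipoch (M%:Z - j))))); last first.
    move=> j; rewrite /tree_coef /burgeT /= !mul1r mul0r expr0z addrK subrK /=; ring.
  rewrite -mulr_zsumr qkummer // qbinomE //.
  have -> : (L + M)%:Z - L%:Z = M by lia.
  rewrite -!PoszD -PoszM -exprnP.
  by rewrite /ipoch /=; field; rewrite !qpoch_neq0.
rewrite [LHS]/=.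
transitivity (\sum_(i < L.+1) zsum L (fun j => tree_coef n j * (q ^ (i%:Z * i%:Z) *
   (qpoch q q (L + L + M - i) * ipoch (L + L)%:Z * ipoch (M%:Z - i%:Z)) *
    burgeT i (L - i) ((fib n.+2)%:Z * j) ((fib n.+1)%:Z * j)))).
  apply: eq_bigr => i _; have iL := ltn_ord i.
  (* Since F_(n+2) >= 1, the terms with |j| > i vanish. All inner sums may thus run over |j| <= L
     and be interchanged with the sum over i. *)
  rewrite IH qbinomE // -(@zsum_widen C i L) //; last first.
    move=> j ij; rewrite /burgeT; have F0 := fib_gt0 n.+1.
    have [j0|j0] := ltP j 0.
      by rewrite (ipoch_lt0 _ _ (i%:Z + _)) ?(mul0r, mulr0) //; nia.
    by rewrite (ipoch_lt0 _ _ (i%:Z - (fib n.+2)%:Z * j)) ?(mul0r, mulr0) //; nia.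
  rewrite mulr_zsumr; apply: eq_zsum => j.
  have -> : absz ((L + L + M)%:Z - i%:Z)%R = (L + L + M - i)%N by lia.
  have -> : (L + L + M)%:Z - i%:Z - (L + L)%:Z = M%:Z - i%:Z by lia.
  by rewrite -mulnn exprnP PoszM; ring.
rewrite zsum_sum; apply: eq_zsum => j.
by rewrite -mulr_sumr burge_transform // -tree_coefS -[RHS]mulrA.
Qed.

(** The prefactor (q)_(2l) will cancel the 1/(q)_(2 m_2) of the summand, leaving the beta side of a
    Bailey pair whose alpha side lives on multiples of F_(n+3). *)
Lemma burge_rootE n l : burge_root n l = qpoch q q (2 * l) *
  zsum l (fun j => tree_coef n.+1 j *
    (ipoch (l%:Z - (fib n.+3)%:Z * j) * ipoch (l%:Z + (fib n.+3)%:Z * j))).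
Proof.
transitivity (\sum_(x < l.+1) zsum l (fun j => tree_coef n j * (q ^ (x%:Z * x%:Z) *
    burgeT x (l - x) ((fib n.+2)%:Z * j) ((fib n.+1)%:Z * j)))).
  apply: eq_bigr => i _; have iL := ltn_ord i.
  rewrite burge_treeE // -(@zsum_widen C i l) //; last first.
    move=> j ij; rewrite /burgeT; have F0 := fib_gt0 n.+1.
    have [j0|j0] := ltP j 0.
      by rewrite (ipoch_lt0 _ _ (i%:Z + _)) ?(mul0r, mulr0) //; nia.
    by rewrite (ipoch_lt0 _ _ (i%:Z - (fib n.+2)%:Z * j)) ?(mul0r, mulr0) //; nia.
  rewrite mulr_zsumr; apply: eq_zsum => j.
  by rewrite -mulnn exprnP PoszM; ring.
rewrite zsum_sum mulr_zsumr; apply: eq_zsum => j.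
by rewrite -mulr_sumr burge_transform_inf // -tree_coefS mul2n -addnn -fibSS; ring.
Qed.

Lemma bailey_step (N f : nat) (a : int -> C) : (0 < f)%N ->
  \sum_(l < N.+1) q ^ (l%:Z * l%:Z) * ipoch (N%:Z - l%:Z) *
     zsum l (fun j => a j * (ipoch (l%:Z - f%:Z * j) * ipoch (l%:Z + f%:Z * j))) =
  zsum N (fun j => a j * q ^ ((f%:Z * j) * (f%:Z * j)) * (ipoch (N%:Z - f%:Z * j) * ipoch (N%:Z + f%:Z * j))).
Proof.
move=> f0.
transitivity (\sum_(l < N.+1) zsum N (fun j => a j * (q ^ (l%:Z * l%:Z) * ipoch (N%:Z - l%:Z) *
     (ipoch (l%:Z - f%:Z * j) * ipoch (l%:Z + f%:Z * j))))).
  apply: eq_bigr => l _; have lN := ltn_ord l.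
  rewrite -(@zsum_widen C l N) //; last first.
    move=> j lj; have fj : (absz j <= absz (f%:Z * j)%R)%N by rewrite abszM leq_pmull.
    have [j0|j0] := ltP (f%:Z * j) 0.
      by rewrite (ipoch_lt0 _ _ (l%:Z + f%:Z * j)) ?(mul0r, mulr0) //; lia.
    by rewrite (ipoch_lt0 _ _ (l%:Z - _)) ?(mul0r, mulr0) //; lia.
  by rewrite mulr_zsumr; apply: eq_zsum => j; ring.
by rewrite zsum_sum; apply: eq_zsum => j; rewrite -mulr_sumr bailey_lemma //; ring.
Qed.

End Tree.

(** * Limits of complex sums and infinite products *)

Section ComplexLimits.
Variable R : realType.
Local Notation C := (complex_complex__canonical__Num_NumField R).
Implicit Types (z w l : C) (u v : nat -> C).

(** The norm on the complex field takes complex values; the estimates need a modulus in R. *)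
Definition cmod z : R := complex.Re `|z|.

Lemma cmodE z : `|z| = (cmod z)%:C%C.
Proof. by rewrite /cmod normc_def. Qed.

Lemma cmod_ge0 z : 0 <= cmod z.
Proof. by rewrite -lecR -cmodE normr_ge0. Qed.

Lemma cmodM z w : cmod (z * w) = cmod z * cmod w.
Proof. by apply: complexI; rewrite rmorphM /= -!cmodE normrM. Qed.

Lemma cmodD z w : cmod (z + w) <= cmod z + cmod w.
Proof. by rewrite -lecR rmorphD /= -!cmodE ler_normD. Qed.

Lemma cmodN z : cmod (- z) = cmod z.
Proof. by rewrite /cmod normrN. Qed.

Lemma cmodB z w : cmod z - cmod w <= cmod (z - w).
Proof. by rewrite -lecR rmorphB /= -!cmodE lerB_dist. Qed.

Lemma cmod0 : cmod 0 = 0.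
Proof. by rewrite /cmod normr0. Qed.

Lemma cmod1 : cmod 1 = 1.
Proof. by rewrite /cmod normr1. Qed.

Lemma cmod_eq0 z : cmod z = 0 -> z = 0.
Proof. by move=> h; apply: normr0_eq0; rewrite cmodE h. Qed.

Lemma cmodX z n : cmod (z ^+ n) = cmod z ^+ n.
Proof. by elim: n => [|n IH]; rewrite ?expr0 ?cmod1 // !exprS cmodM IH. Qed.

Lemma cmod_sum n u : cmod (\sum_(i < n) u i) <= \sum_(i < n) cmod (u i).
Proof.
elim: n => [|n IH]; first by rewrite !big_ord0 cmod0.
by rewrite !big_ord_recr /=; apply: le_trans (cmodD _ _) _; rewrite lerD2r.
Qed.

Lemma cmod_ReIm z : cmod z <= `|complex.Re z| + `|complex.Im z|.
Proof.
have h (x : R) : cmod x%:C%C = `|x| by rewrite /cmod normc_def /= expr0n addr0 sqrtr_sqr.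
have -> : z = (complex.Re z)%:C%C + 'i%C * (complex.Im z)%:C%C by rewrite -complexE.
apply: le_trans (cmodD _ _) _; rewrite cmodM !h /=.
have -> : cmod 'i%C = 1 by rewrite /cmod normc_def /= expr0n add0r expr1n sqrtr1.
by rewrite !(mul0r, mul1r, addr0, add0r, subr0).
Qed.

Lemma Re_le_cmod z : `|complex.Re z| <= cmod z.
Proof. by rewrite -lecR -cmodE normc_ge_Re. Qed.

Lemma Im_le_cmod z : `|complex.Im z| <= cmod z.
Proof.
rewrite /cmod normc_def /= -[X in X <= _]ger0_norm // -sqrtr_sqr ler_sqrt ?real_normK ?num_real //.
  by rewrite lerDr sqr_ge0.
by rewrite addr_ge0 ?sqr_ge0.
Qed.

Lemma cvg_cmodP u l : (u @ \oo --> l) <-> ((fun n => cmod (u n - l)) @ \oo --> (0 : R)).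
Proof.
split => [/cvgrPdist_lt h|/cvgrPdist_lt h].
  apply/cvgrPdist_lt => e e0.
  have e0' : 0 < e%:C%C :> C by rewrite ltcR.
  have := h _ e0'; apply: filterS => n.
  move=> hn; rewrite sub0r normrN ger0_norm ?cmod_ge0 // -ltcR -cmodN opprB -cmodE; exact: hn.
apply/cvgrPdist_lt => e e0.
(* A positive element of the complex order is real, so its real part can serve as the epsilon. *)
have eE : e = (complex.Re e)%:C%C by rewrite RRe_real // gtr0_real.
have e0' : 0 < complex.Re e by rewrite -ltcR -eE.
have := h _ e0'; apply: filterS => n.
rewrite sub0r normrN ger0_norm ?cmod_ge0 // -ltcR -cmodN opprB -cmodE -eE; exact.
Qed.

Lemma cvg_le_cmod u l (v : nat -> R) : (forall n, cmod (u n - l) <= v n) ->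
  v @ \oo --> (0 : R) -> u @ \oo --> l.
Proof.
move=> uv v0; apply/cvg_cmodP.
apply: (@squeeze_cvgr _ _ _ _ (fun=> 0) v) v0; last exact: cvg_cst.
by apply: nearW => n; rewrite cmod_ge0 uv.
Qed.

Lemma cmod_dist z w : `|cmod z - cmod w| <= cmod (z - w).
Proof. by rewrite ler_norml cmodB andbT lerNl opprB -[cmod (z - w)]cmodN opprB cmodB. Qed.

Lemma cvg_cmod u l : u @ \oo --> l -> (fun n => cmod (u n)) @ \oo --> cmod l.
Proof.
move=> /cvg_cmodP /cvgrPdist_lt h; apply/cvgrPdist_lt => e e0.
apply: filterS (h e e0) => n; rewrite sub0r normrN (ger0_norm (cmod_ge0 _)).
by apply: le_lt_trans; rewrite -[leRHS]cmodN opprB cmod_dist.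
Qed.

Lemma cvg_uniq u l w : u @ \oo --> l -> u @ \oo --> w -> l = w.
Proof. by move=> ul uw; apply: (cvg_unique _ ul uw); exact: norm_hausdorff. Qed.

Lemma geo_sum_le (r : R) n : 0 <= r < 1 -> \sum_(i < n) r ^+ i <= (1 - r)^-1.
Proof.
move=> /andP[r0 r1]; rewrite -[leRHS]mul1r ler_pdivlMr ?subr_gt0 // -opprB mulrN.
by rewrite mulrC -subrX1 opprB gerBl exprn_ge0.
Qed.

Lemma cvg_geometric_0 (K r : R) : 0 <= r < 1 -> (fun n => K * r ^+ n) @ \oo --> (0 : R).
Proof.
move=> /andP[r0 r1]; rewrite -(mulr0 K); apply: cvgMr; apply: cvg_expr.
by rewrite ger0_norm.
Qed.

Lemma real_cvg_geo_series (K r : R) (v : nat -> R) : 0 <= r < 1 ->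
  (forall i, `|v i| <= K * r ^+ i) -> exists S : R, (fun n => \sum_(i < n) v i) @ \oo --> S.
Proof.
move=> r01 vK; have : cvgn (series v).
  apply: (@normed_cvg R R^o v); apply: (@series_le_cvg R _ (geometric K r)) => [n|n|n|] /=.
  - exact: normr_ge0.
  - by rewrite (le_trans _ (vK n)).
  - exact: vK.
  - by apply: is_cvg_geometric_series; case/andP: r01 => r0 r1; rewrite ger0_norm.
move=> h; exists (limn (series v)).
rewrite (_ : (fun n => _) = series v) //.
by apply/funext => n; rewrite seriesEnat /= big_mkord.
Qed.

Lemma cvg_geo_series (K r : R) u : 0 <= r < 1 ->
  (forall i, cmod (u i) <= K * r ^+ i) -> exists S : C, (fun n => \sum_(i < n) u i) @ \oo --> S.
Proof.
move=> r01 uK.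
have [a ha] := real_cvg_geo_series _ _ (fun i => complex.Re (u i)) r01 (fun i => le_trans (Re_le_cmod _) (uK i)).
have [b hb] := real_cvg_geo_series _ _ (fun i => complex.Im (u i)) r01 (fun i => le_trans (Im_le_cmod _) (uK i)).
exists (Complex a b).
apply: (@cvg_le_cmod _ _ (fun n => `|\sum_(i < n) complex.Re (u i) - a| + `|\sum_(i < n) complex.Im (u i) - b|)).
  move=> n; apply: le_trans (cmod_ReIm _) _; rewrite !raddfB !raddf_sum /=; exact: lexx.
have c0 (f : nat -> R) x : f @ \oo --> x -> (fun n => `|f n - x|) @ \oo --> (0 : R).
  move=> fx; rewrite -(normr0 R) -(subrr x); apply: cvg_norm; apply: cvgB => //; exact: cvg_cst.
by have := cvgD (c0 _ _ ha) (c0 _ _ hb); rewrite addr0; apply.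
Qed.

(** Dominated convergence when the number of terms grows together with n. Beyond a fixed J the
    differences add up to at most 2K r^J/(1-r), and the first J terms converge one by one. *)
Lemma tannery (K r : R) (f : nat -> nat -> C) (g : nat -> C) : 0 <= r < 1 ->
  (forall n i, cmod (f n i) <= K * r ^+ i) -> (forall i, (fun n => f n i) @ \oo --> g i) ->
  exists S : C, (fun n => \sum_(i < n) g i) @ \oo --> S /\ (fun n => \sum_(i < n) f n i) @ \oo --> S.
Proof.
move=> r01 fK fg; have [r0 r1] := andP r01.
have gK i : cmod (g i) <= K * r ^+ i.
  by apply: (cvgr_to_le (cvg_cmod _ _ (fg i))); apply: nearW => n.
have [S hS] := cvg_geo_series _ _ _ r01 gK; exists S; split => //.
have K0 : 0 <= K by have := gK 0%N; rewrite expr0 mulr1; apply: le_trans; exact: cmod_ge0.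
suff d0 : (fun n => \sum_(i < n) (f n i - g i)) @ \oo --> (0 : C).
  have -> : (fun n => \sum_(i < n) f n i) = (fun n => \sum_(i < n) g i + \sum_(i < n) (f n i - g i)).
    by apply/funext => n; rewrite -big_split /=; apply: eq_bigr => i _; rewrite addrC subrK.
  by have := cvgD hS d0; rewrite addr0; apply.
apply/cvg_cmodP; apply/cvgrPdist_lt => e e0.
have e2 : 0 < e / 2 by rewrite divr_gt0.
have /cvgrPdist_lt/(_ _ e2) [J _ hJ] := cvg_geometric_0 (2 * K / (1 - r)) r r01.
have {hJ} tailJ : 2 * K / (1 - r) * r ^+ J < e / 2.
  have := hJ J (leqnn J); rewrite sub0r normrN ger0_norm //.
  by rewrite mulr_ge0 ?exprn_ge0 // divr_ge0 ?mulr_ge0 // subr_ge0 ltW.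
have head : (fun n => \sum_(i < J) cmod (f n i - g i)) @ \oo --> (0 : R).
  elim: J {tailJ} => [|J IH].
    by under eq_fun do rewrite big_ord0; exact: cvg_cst.
  under eq_fun do rewrite big_ord_recr /=.
  have /cvg_cmodP h := fg J.
  by have := cvgD IH h; rewrite addr0; apply.
have /cvgrPdist_lt/(_ _ e2) := head.
apply: filter_app; near=> n => hn.
have Jn : (J <= n)%N by near: n; exact: nbhs_infty_ge.
rewrite sub0r normrN ger0_norm ?cmod_ge0 // subr0.
move: hn; rewrite sub0r normrN ger0_norm; last by apply: sumr_ge0 => i _; exact: cmod_ge0.
move=> hn; apply: le_lt_trans (cmod_sum _ (fun i => f n i - g i)) _.
have -> : \sum_(i < n) cmod (f n i - g i) =
    \sum_(i < J) cmod (f n i - g i) + \sum_(i < n - J) cmod (f n (J + i)%N - g (J + i)%N).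
  by rewrite -[in LHS](subnKC Jn) big_split_ord /= !subnKC.
rewrite [e]splitr; apply: ltr_leD => //.
apply: le_trans (ltW tailJ).
apply: (@le_trans _ _ (\sum_(i < n - J) 2 * K * r ^+ J * r ^+ i)).
  apply: ler_sum => i _; apply: le_trans (cmodD _ _) _; rewrite cmodN.
  rewrite -mulrA -exprD -mulrA mulrDl mul1r.
  by apply: lerD; [exact: fK|exact: gK].
rewrite -mulr_sumr [leRHS]mulrAC; apply: ler_wpM2l; last exact: geo_sum_le.
by rewrite !mulr_ge0 ?exprn_ge0.
Unshelve. all: by end_near. Qed.

Lemma zsum_tannery (K r : R) (f : nat -> int -> C) (g : int -> C) : 0 <= r < 1 ->
  (forall n j, cmod (f n j) <= K * r ^+ absz j) -> (forall j, (fun n => f n j) @ \oo --> g j) ->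
  exists S : C, (fun n => zsum C n g) @ \oo --> S /\ (fun n => zsum C n (f n)) @ \oo --> S.
Proof.
move=> r01 fK fg.
have [||S [gS fS]] := tannery (2 * K * r) r (fun n i => f n i.+1%:Z + f n (- i.+1%:Z))
    (fun i => g i.+1%:Z + g (- i.+1%:Z)) r01.
- move=> n i; apply: le_trans (cmodD _ _) _.
  have -> : 2 * K * r * r ^+ i = K * r ^+ i.+1 + K * r ^+ i.+1 by rewrite exprS; ring.
  by apply: lerD; [exact: (fK n i.+1%:Z)|exact: (fK n (- i.+1%:Z))].
- by move=> i; apply: cvgD; exact: fg.
exists (g 0 + S); split; first exact: (cvgD (cvg_cst (g 0)) gS).
exact: (cvgD (fg 0) fS).
Qed.

Lemma cmod_zsum (K r : R) (f : int -> C) n : 0 <= r < 1 ->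
  (forall j, cmod (f j) <= K * r ^+ absz j) -> cmod (zsum C n f) <= K + 2 * K * r / (1 - r).
Proof.
move=> r01 fK; have [r0 r1] := andP r01.
have K0 : 0 <= K by have := fK 0; rewrite expr0 mulr1; apply: le_trans; exact: cmod_ge0.
apply: le_trans (cmodD _ _) _; apply: lerD; first by have := fK 0; rewrite expr0 mulr1.
apply: le_trans (cmod_sum _ (fun i => f i.+1%:Z + f (- i.+1%:Z))) _.
apply: (@le_trans _ _ (\sum_(i < n) 2 * K * r * r ^+ i)).
  apply: ler_sum => i _; apply: le_trans (cmodD _ _) _.
  have -> : 2 * K * r * r ^+ i = K * r ^+ i.+1 + K * r ^+ i.+1 by rewrite exprS; ring.
  by apply: lerD; [exact: (fK i.+1%:Z)|exact: (fK (- i.+1%:Z))].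
rewrite -mulr_sumr; apply: ler_wpM2l; last exact: geo_sum_le.
by rewrite !mulr_ge0.
Qed.

End ComplexLimits.

(** * Infinite products and theta series *)

Section InfiniteProducts.
Variable R : realType.
Local Notation C := (complex_complex__canonical__Num_NumField R).
Variable q : C.
Hypothesis q_lt1 : cmod R q < 1.
Local Notation cmod := (cmod R).

Lemma cmodq01 : 0 <= cmod q < 1. Proof. by rewrite cmod_ge0. Qed.
Hint Resolve cmodq01 : core.

Lemma expq_neq1 n : q ^+ n.+1 != 1.
Proof.
apply/eqP => h; have := exprn_ilt1 n.+1 (cmod_ge0 _ q) q_lt1.
by rewrite -cmodX h cmod1 ltxx.
Qed.

Lemma cmod_qpoch x n : cmod (qpoch x q n) <= expR (cmod x / (1 - cmod q)).
Proof.
apply: (@le_trans _ _ (expR (cmod x * \sum_(i < n) cmod q ^+ i))).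
  elim: n => [|n IH]; first by rewrite qpoch0 cmod1 big_ord0 mulr0 expR0.
  rewrite qpochS cmodM big_ord_recr mulrDr expRD; apply: ler_pM; [exact: cmod_ge0|exact: cmod_ge0|exact: IH|].
  apply: le_trans (cmodD _ _ _) _; rewrite cmodN cmod1 cmodM cmodX; exact: expR_ge1Dx.
by rewrite ler_expR; apply: ler_wpM2l; [exact: cmod_ge0|exact: geo_sum_le].
Qed.

(** A bound uniform in n, which keeps (q)_oo away from 0 and bounds every [ipoch]. For x = |q|^n one
    has 1 <= (1 - |q| x)(1 + x/(1-|q|)), and the last factor is at most exp(x/(1-|q|)); summing the
    exponents gives (1-|q|)^-2. *)
Lemma cmod_qpoch_ge n : expR (- (1 - cmod q) ^- 2) <= cmod (qpoch q q n).
Proof.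
have d0 : 0 < 1 - cmod q by rewrite subr_gt0.
suff h : 1 <= cmod (qpoch q q n) * expR ((\sum_(i < n) cmod q ^+ i) / (1 - cmod q)).
  rewrite expRN -[leLHS]mul1r ler_pdivrMr ?expR_gt0 //; apply: le_trans h _.
  apply: ler_wpM2l; first exact: cmod_ge0.
  rewrite ler_expR expr2 invfM; apply: ler_wpM2r; first by rewrite invr_ge0 ltW.
  exact: geo_sum_le.
elim: n => [|n IH]; first by rewrite qpoch0 cmod1 big_ord0 mul0r expR0 mulr1.
rewrite qpochS cmodM big_ord_recr mulrDl expRD mulrACA -[leLHS]mulr1.
apply: ler_pM => //; set x := cmod q ^+ n.
have x0 : 0 <= x by rewrite exprn_ge0 ?cmod_ge0.
have x1 : x <= 1 by rewrite exprn_ile1 ?cmod_ge0 // ltW.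
have qx : cmod q * x <= cmod q by rewrite ler_piMr ?cmod_ge0.
have qx0 : 0 <= cmod q * x by rewrite mulr_ge0 ?cmod_ge0.
have h1 : 1 - cmod q * x <= cmod (1 - q * q ^+ n).
  by have := cmodB _ 1 (q * q ^+ n); rewrite cmod1 cmodM cmodX.
have h2 : 1 + x / (1 - cmod q) <= expR (x / (1 - cmod q)) by exact: expR_ge1Dx.
have h3 : 1 <= (1 - cmod q * x) * (1 + x / (1 - cmod q)).
  rewrite -subr_ge0.
  have -> : (1 - cmod q * x) * (1 + x / (1 - cmod q)) - 1 =
     x * (1 - cmod q * x - cmod q * (1 - cmod q)) / (1 - cmod q) by field; rewrite gt_eqF.
  rewrite divr_ge0 ?(ltW d0) // mulr_ge0 //.
  have := cmod_ge0 _ q; nra.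
apply: le_trans h3 _; apply: ler_pM => //.
  by rewrite subr_ge0; apply: le_trans qx _; exact: ltW.
by rewrite addr_ge0 // divr_ge0 // ltW.
Qed.

(** [qpoch_inf] is a bare [lim], so convergence must be shown: successive partial products differ by
    a geometrically small amount. *)
Lemma cvg_qpoch x : qpoch x q @ \oo --> qpoch_inf x q.
Proof.
suff [l hl] : exists l : C, qpoch x q @ \oo --> l by apply: (cvgP l); exact: hl.
have [|S hS] := cvg_geo_series _ (expR (cmod x / (1 - cmod q)) * cmod x) (cmod q)
    (fun i => qpoch x q i.+1 - qpoch x q i) cmodq01.
  move=> i; rewrite qpochS mulrBr mulr1 [_ - _ - _]addrAC subrr add0r cmodN !cmodM cmodX mulrA.
  by rewrite !ler_wpM2r ?exprn_ge0 ?cmod_ge0 ?cmod_qpoch.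
exists (1 + S).
rewrite (_ : qpoch x q = fun n => 1 + \sum_(i < n) (qpoch x q i.+1 - qpoch x q i)).
  exact: (cvgD (cvg_cst (1 : C)) hS).
apply/funext; elim=> [|n IH]; first by rewrite big_ord0 qpoch0 addr0.
by rewrite big_ord_recr addrA -IH addrC subrK.
Qed.

Lemma qpoch_inf_neq0 : qpoch_inf q q != 0.
Proof.
apply/eqP => h; have := cvg_cmod _ _ _ (cvg_qpoch q); rewrite h cmod0 => h0.
have : expR (- (1 - cmod q) ^- 2) <= 0.
  by apply: (cvgr_to_ge h0); apply: nearW => n; exact: cmod_qpoch_ge.
by rewrite leNgt expR_gt0.
Qed.

Lemma cmod_ipoch z : cmod (ipoch C q z) <= expR ((1 - cmod q) ^- 2).
Proof.
have [z0|z0] := ltP z 0; first by rewrite ipoch_lt0 // cmod0 expR_ge0.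
have -> : ipoch C q z = (qpoch q q (absz z))^-1 by case: z z0.
set p := qpoch _ _ _; have p0 : p != 0 by apply: qpoch_neq0; exact: expq_neq1.
have np0 : 0 < cmod p.
  by rewrite lt_def cmod_ge0 andbT; apply: contra p0 => /eqP /cmod_eq0 ->.
have -> : cmod p^-1 = (cmod p)^-1.
  by apply: (mulfI (lt0r_neq0 np0)); rewrite -cmodM mulfV // cmod1 mulfV // lt0r_neq0.
by rewrite -[leRHS]invrK -expRN lef_pV2 ?posrE ?expR_gt0 //; exact: cmod_qpoch_ge.
Qed.

Lemma cvg_ipoch (a : int) : (fun n : nat => ipoch C q (n%:Z + a)) @ \oo --> (qpoch_inf q q)^-1.
Proof.
have h : (fun n : nat => ipoch C q n%:Z) @ \oo --> (qpoch_inf q q)^-1.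
  exact: (cvgV qpoch_inf_neq0 (cvg_qpoch q)).
case: a => [k|k].
  have := h; rewrite -(cvg_shiftn k).
  by congr (_ @ _ --> _); apply/funext => n; rewrite PoszD.
rewrite -(cvg_shiftn k.+1); move: h.
rewrite (_ : (fun n : nat => ipoch C q n%:Z) = (fun n : nat => ipoch C q ((n + k.+1)%N%:Z + Negz k))) //.
by apply/funext => n; congr (ipoch _ _ _); lia.
Qed.

Lemma cmod_expz z : 0 <= z -> cmod (q ^ z) = cmod q ^+ absz z.
Proof. by case: z => // n _; rewrite -exprnP cmodX. Qed.

Lemma cmod_alt j : cmod (alt C j) = 1.
Proof.
have h n : cmod (alt C (Posz n)) = 1 by rewrite /alt -exprnP cmodX cmodN cmod1 expr1n.
by case: (intP j) => [|n|n]; rewrite ?altN h.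
Qed.

Hypothesis q_neq0 : q != 0.

(** [tree_coef] with an arbitrary coefficient c of j^2; the full exponent of q is j(j+1)/2 + c
    j^2. *)
Definition theta (c : nat) (j : int) : C := q ^ j * qsign C q j * q ^ (c%:Z * (j * j)).

Lemma thetaE c j : theta c j = alt C j * q ^ (tri j + j + c%:Z * (j * j)).
Proof. by rewrite /theta /qsign !expD //; ring. Qed.

(** Here j(j+1)/2 >= 0 and c j^2 >= |j|. Positivity of c matters at j = -1, where the first part is
    0. *)
Lemma cmod_theta c j : (0 < c)%N -> cmod (theta c j) <= cmod q ^+ absz j.
Proof.
move=> c0; rewrite thetaE cmodM cmod_alt mul1r.
have z0 : `|j| <= tri j + j + c%:Z * (j * j).
  have := tri2 j; nia.
rewrite cmod_expz; last by apply: le_trans z0; exact: normr_ge0.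
apply: ler_wiXn2l; [exact: cmod_ge0|exact: ltW|].
by rewrite -lez_nat; apply: (le_trans _ (ler_norm _)); rewrite abszE.
Qed.

End InfiniteProducts.

(** Jacobi's triple product in base Q = q^(2P-1) at z = q^P, because j(j+1)/2 + (P-1) j^2 = (2P-1)
    j(j-1)/2 + P j. In the finite form the weights tend to 1/(Q)_oo^2, which is then cleared. *)
Lemma cvg_theta (R : realType) (q : complex_complex__canonical__Num_NumField R) (P : nat) :
  cmod R q < 1 -> q != 0 -> (1 < P)%N ->
  (fun n => zsum _ n (theta R q (P - 1))) @ \oo -->
    qpoch_inf (q ^+ (P - 1)) (q ^+ (2 * P - 1)) * qpoch_inf (q ^+ P) (q ^+ (2 * P - 1))
      * qpoch_inf (q ^+ (2 * P - 1)) (q ^+ (2 * P - 1)).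
Proof.
move=> q1 q0 P1; set Q := q ^+ (2 * P - 1); set z := q ^+ P.
have Q0 : Q != 0 by rewrite expf_neq0.
have z0 : z != 0 by rewrite expf_neq0.
have Q1 : cmod R Q < 1 by rewrite cmodX exprn_ilt1 ?cmod_ge0 //; lia.
have Qz : Q / z = q ^+ (P - 1).
  by apply: (mulIf z0); rewrite mulfVK // -exprD; congr (_ ^+ _); lia.
have tE j : theta R q (P - 1) j = qsign _ Q j * z ^ j.
  rewrite thetaE // /qsign -mulrA /Q /z !exprnP !exprz_exp -expfzDr //; congr (_ * q ^ _).
  have := tri2 j; have : (P - 1)%:Z = P%:Z - 1 by lia.
  have -> : (2 * P - 1)%:Z = 2 * P%:Z - 1 by lia.
  move=> ->; nia.
set I := (qpoch_inf Q Q)^-1.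
have I0 : qpoch_inf Q Q != 0 by exact: qpoch_inf_neq0.
pose B := expR ((1 - cmod R Q) ^- 2).
have [||S [gS fS]] := zsum_tannery R (B * B) (cmod R q)
   (fun n j => theta R q (P - 1) j * (ipoch _ Q (n%:Z - j) * ipoch _ Q (n%:Z + j)))
   (fun j => theta R q (P - 1) j * (I * I)) (cmodq01 _ _ q1).
- move=> n j; rewrite cmodM [leLHS]mulrC cmodM; apply: ler_pM; rewrite ?mulr_ge0 ?cmod_ge0 //.
    by apply: ler_pM; rewrite ?cmod_ge0 // cmod_ipoch.
  by apply: cmod_theta => //; lia.
- move=> j; apply: cvgMr; apply: cvgM; exact: cvg_ipoch.
have fS' : (fun n => zsum _ n (fun j => theta R q (P - 1) j * (ipoch _ Q (n%:Z - j) * ipoch _ Q (n%:Z + j)))) @ \oo -->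
    qpoch_inf z Q * qpoch_inf (q ^+ (P - 1)) Q * I.
  rewrite (_ : (fun n => _) = fun n => qpoch z Q n * qpoch (q ^+ (P - 1)) Q n * ipoch _ Q n.*2%:Z).
    apply: cvgM; first by apply: cvgM; exact: cvg_qpoch.
    have h := cvg_ipoch R Q Q1 0.
    have d : (fun n => n.*2) @ \oo --> \oo.
      by move=> A [N _ NA]; exists N => // n /= Nn; apply: NA => /=; lia.
    have := cvg_comp _ _ d h.
    rewrite (_ : (fun n : nat => ipoch _ Q n.*2%:Z) = (fun n : nat => ipoch _ Q (n%:Z + 0)) \o double) //.
    by apply/funext => n; rewrite /= addn0.
  apply/funext => n; rewrite -Qz -(finite_jacobi_triple _ _ (expq_neq1 _ _ Q1) Q0) //.
  by apply: eq_zsum => j; rewrite tE.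
have SE := cvg_uniq _ _ _ _ fS fS'.
rewrite (_ : (fun n => _) = fun n => zsum _ n (fun j => theta R q (P - 1) j * (I * I)) * (qpoch_inf Q Q * qpoch_inf Q Q)); last first.
  apply/funext => n; rewrite mulrC mulr_zsumr; apply: eq_zsum => j.
  by rewrite /I; field.
have -> : qpoch_inf (q ^+ (P - 1)) Q * qpoch_inf z Q * qpoch_inf Q Q = S * (qpoch_inf Q Q * qpoch_inf Q Q).
  by rewrite SE /I; field.
exact: (cvgM gS (cvg_cst (qpoch_inf Q Q * qpoch_inf Q Q))).
Qed.

(** * The limit of the multisum *)

Section MultisumLimit.
Variable R : realType.
Local Notation C := (complex_complex__canonical__Num_NumField R).
Variables (q : C) (n : nat).
Hypotheses (q_lt1 : cmod R q < 1) (q_neq0 : q != 0).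
Local Notation cmod := (cmod R).
Local Notation r := (cmod q).
Local Notation ipoch := (ipoch C q).
Local Notation theta := (theta R q).
Local Notation I := (qpoch_inf q q)^-1.
Local Notation B := (expR ((1 - r) ^- 2)).
Local Notation F := (fib n.+3).
Local Notation P := (fib n.+3 * fib n.+4.+1)%N.

Let r01 : 0 <= r < 1 := cmodq01 R q q_lt1.
Let r0 : 0 <= r := cmod_ge0 R q.
Let q_neq1 := expq_neq1 R q q_lt1.
Let B0 : 0 <= B := expR_ge0 _.

Definition ipoch_pair (N : nat) (j : int) : C := ipoch (N%:Z - F%:Z * j) * ipoch (N%:Z + F%:Z * j).

Lemma cmod_theta_pair c N j : (0 < c)%N -> cmod (theta c j * ipoch_pair N j) <= B * B * r ^+ absz j.
Proof.
move=> c0; rewrite cmodM [leLHS]mulrC cmodM; apply: ler_pM; rewrite ?mulr_ge0 ?cmod_ge0 //.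
  by apply: ler_pM; rewrite ?cmod_ge0 // cmod_ipoch.
exact: cmod_theta.
Qed.

Definition bailey_sum (c N : nat) : C := zsum C N (fun j => theta c j * ipoch_pair N j).

Local Notation K := (B * B + 2 * (B * B) * r / (1 - r)).

Lemma cmod_bailey_sum c N : (0 < c)%N -> cmod (bailey_sum c N) <= K.
Proof. by move=> c0; apply: cmod_zsum => // j; exact: cmod_theta_pair. Qed.

Lemma K_ge0 : 0 <= K.
Proof. exact: le_trans (cmod_ge0 _ _) (@cmod_bailey_sum 1 0 isT). Qed.

(** The Bailey chain: [beta'] comes from the sum over m_2 and [beta''] from the sum over m_1 + m_2.
    Both steps add the same F_(n+3)^2, so F_(n+2) F_(n+3) grows to F_(n+3) F_(n+4) and then to
    F_(n+3) F_(n+5), which is F_(k-2) F_k. *)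
Local Notation beta := (bailey_sum (fib n.+2 * fib n.+3 - 1)).
Local Notation beta' := (bailey_sum (fib n.+3 * fib n.+4 - 1)).
Local Notation beta'' := (bailey_sum (P - 1)).

Lemma burge_root_beta l : burge_root C q n l = qpoch q q (2 * l) * beta l.
Proof. exact: burge_rootE. Qed.

Lemma beta'E N : beta' N = \sum_(l < N.+1) q ^ (l%:Z * l%:Z) * ipoch (N%:Z - l%:Z) * beta l.
Proof.
rewrite /bailey_sum bailey_step ?fib_gt0 //; apply: eq_zsum => j.
by have -> := tree_coefS C q q_neq0 n.+1 j.
Qed.

Lemma beta''E N : beta'' N = \sum_(l < N.+1) q ^ (l%:Z * l%:Z) * ipoch (N%:Z - l%:Z) * beta' l.
Proof.
rewrite /bailey_sum bailey_step ?fib_gt0 //; apply: eq_zsum => j; congr (_ * _).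
rewrite /theta -[RHS]mulrA -expD //; congr (_ * q ^ _).
have -> : (P - 1 = (fib n.+3 * fib n.+4 - 1) + fib n.+3 * fib n.+3)%N.
  by rewrite (fibSS n.+3) mulnDr; have := fib_coef_gt0 n.+1; lia.
by rewrite PoszD PoszM; ring.
Qed.

Lemma expr_sqr_le s : r ^+ absz (s%:Z * s%:Z)%R <= r ^+ s.
Proof. by apply: ler_wiXn2l; [|exact: ltW|nia]. Qed.

(** What is left of the summand after the inner summation, with s = m_1 + m_2 and l = m_2. *)
Definition double_term (s l : nat) : C :=
  q ^ (s%:Z * s%:Z) * ipoch (s%:Z - l%:Z) * (q ^ (l%:Z * l%:Z) * beta l).

Lemma cmod_double_term s l : cmod (double_term s l) <= B * K * r ^+ s * r ^+ l.
Proof.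
rewrite /double_term !cmodM !cmod_expz //.
have -> : B * K * r ^+ s * r ^+ l = r ^+ s * B * (r ^+ l * K) by ring.
have h m := expr_sqr_le m.
apply: ler_pM; rewrite ?mulr_ge0 ?cmod_ge0 ?exprn_ge0 //.
  by apply: ler_pM; rewrite ?cmod_ge0 ?exprn_ge0 // cmod_ipoch.
by apply: ler_pM; rewrite ?cmod_ge0 ?exprn_ge0 // cmod_bailey_sum // fib_coef_gt0.
Qed.

Lemma sum_beta' N :
  \sum_(s < N) q ^ (s%:Z * s%:Z) * beta' s =
  \sum_(l < N) \sum_(m < N - l) double_term (m + l) l.
Proof.
transitivity (\sum_(s < N) \sum_(l < N) double_term s l).
  apply: eq_bigr => s _; rewrite beta'E mulr_sumr.
  rewrite [RHS](@sum_ord_widen C (double_term s) s.+1) //.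
    by apply: eq_bigr => l _; rewrite /double_term; ring.
  by move=> l sl; rewrite /double_term ipoch_lt0 ?(mulr0, mul0r) //; lia.
rewrite exchange_big; apply: eq_bigr => l _ /=.
have lN := ltn_ord l; rewrite (@sum_ord_split C (double_term^~ l) l N) 1?ltnW //= big1 ?add0r.
  by apply: eq_bigr => m _; rewrite addnC.
by move=> s _; rewrite /double_term ipoch_lt0 ?(mulr0, mul0r) //; have := ltn_ord s; lia.
Qed.

Lemma box_sum_double N : box_sum (n + 5 - 2) N (summand (n + 5) q) =
  \sum_(l < N) \sum_(m < N) double_term (m + l) l.
Proof.
rewrite box_sum_summand exchange_big; apply: eq_bigr => l _; apply: eq_bigr => m _.
have p0 k : qpoch q q k != 0 by exact: qpoch_neq0.
rewrite burge_root_beta /double_term exprD.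
have -> : (m + l)%:Z - l%:Z = m by lia.
rewrite -!PoszM -!exprnP !mulnn; change (ipoch m) with (qpoch q q m)^-1.
by field; rewrite !p0.
Qed.

(** The square m_1, m_2 < N and the triangle m_1 + m_2 < N differ by terms with m_1 + m_2 >= N.
    These carry a factor r^N, and two geometric sums supply (1-r)^-2. *)
Lemma cvg_box_sub : (fun N => box_sum (n + 5 - 2) N (summand (n + 5) q)
    - \sum_(s < N) q ^ (s%:Z * s%:Z) * beta' s) @ \oo --> (0 : C).
Proof.
have d0 : 0 < 1 - r by rewrite subr_gt0.
have K0 := K_ge0.
apply: (@cvg_le_cmod _ _ _ (fun N => B * K / (1 - r) / (1 - r) * r ^+ N)); last exact: cvg_geometric_0.
move=> N; rewrite subr0 box_sum_double sum_beta' -sumrB.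
apply: le_trans (cmod_sum _ _ (fun l => \sum_(m < N) double_term (m + l) l - \sum_(m < N - l) double_term (m + l) l)) _.
apply: (@le_trans _ _ (\sum_(l < N) B * K / (1 - r) * r ^+ N * r ^+ l)).
  apply: ler_sum => l _; have lN := ltn_ord l.
  have -> : \sum_(m < N) double_term (m + l) l - \sum_(m < N - l) double_term (m + l) l =
      \sum_(m < l) double_term (N + m) l.
    rewrite (@sum_ord_split C (fun m => double_term (m + l) l) (N - l) N) ?leq_subr //.
    rewrite addrC addKr subKn 1?ltnW //.
    by apply: eq_bigr => m _; congr double_term; lia.
  apply: le_trans (cmod_sum _ _ (fun m => double_term (N + m) l)) _.
  apply: (@le_trans _ _ (\sum_(m < l) B * K * r ^+ N * r ^+ l * r ^+ m)).
    apply: ler_sum => m _; apply: le_trans (cmod_double_term _ _) _.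
    by rewrite exprD le_eqVlt; apply/orP; left; apply/eqP; ring.
  rewrite -mulr_sumr.
  have -> : B * K / (1 - r) * r ^+ N * r ^+ l = B * K * r ^+ N * r ^+ l * (1 - r)^-1 by ring.
  by apply: ler_wpM2l; [rewrite !mulr_ge0 ?exprn_ge0|exact: geo_sum_le].
rewrite -mulr_sumr.
have -> : B * K / (1 - r) / (1 - r) * r ^+ N = B * K / (1 - r) * r ^+ N * (1 - r)^-1 by ring.
by apply: ler_wpM2l; [rewrite !mulr_ge0 ?exprn_ge0 // invr_ge0 ltW|exact: geo_sum_le].
Qed.

(** The limit of [beta''] is computed twice: as the sum of q^(s^2) [beta'] s divided by (q)_oo, and
    as T/(q)_oo^2. Cancelling one factor (q)_oo evaluates the sum over the triangle. *)
Lemma cvg_box_sum (T : C) : (fun N => zsum C N (theta (P - 1))) @ \oo --> T ->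
  (fun N => box_sum (n + 5 - 2) N (summand (n + 5) q)) @ \oo --> T * I.
Proof.
move=> thetaT.
have I0 : I != 0 by rewrite invr_neq0 // qpoch_inf_neq0.
(* The offset -1 fits the range s < M of [tannery]: the value at M + 1 is [beta''] at M. *)
have [||S [gS fS]] := tannery R (K * B) r
    (fun M s => q ^ (s%:Z * s%:Z) * beta' s * ipoch (M%:Z + (- 1 - s%:Z)))
    (fun s => q ^ (s%:Z * s%:Z) * beta' s * I) r01.
- move=> M s; rewrite !cmodM cmod_expz //.
  have -> : K * B * r ^+ s = r ^+ s * K * B by ring.
  apply: ler_pM; rewrite ?mulr_ge0 ?cmod_ge0 ?exprn_ge0 ?cmod_ipoch //.
  apply: ler_pM; rewrite ?cmod_ge0 ?exprn_ge0 ?expr_sqr_le //.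
  by rewrite cmod_bailey_sum // fib_coef_gt0.
- by move=> s; apply: cvgMr; exact: cvg_ipoch.
have [||S' [gS' fS']] := zsum_tannery R (B * B) r
    (fun M j => theta (P - 1) j * ipoch_pair M j) (fun j => theta (P - 1) j * (I * I)) r01.
- move=> M j; apply: cmod_theta_pair.
  by have := fib_coef_gt0 n.+1; rewrite (fibSS n.+3) mulnDr; lia.
- by move=> j; apply: cvgMr; apply: cvgM; exact: cvg_ipoch.
have SS' : S = S'.
  apply: (@cvg_uniq R (beta'')) fS'.
  pose E M := \sum_(s < M) q ^ (s%:Z * s%:Z) * beta' s * ipoch (M%:Z + (- 1 - s%:Z)).
  have -> : beta'' = fun M => E M.+1.
    apply/funext => M; rewrite beta''E; apply: eq_bigr => s _.
    have -> : M.+1%:Z + (- 1 - s%:Z) = M%:Z - s%:Z by lia.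
    by ring.
  have d : succn @ \oo --> \oo.
    by move=> A [N _ NA]; exists N => // k /= Nk; apply: NA => /=; lia.
  exact: (cvg_comp succn E d fS).
have S'T : S' = T * (I * I).
  apply: (cvg_uniq _ _ _ _ gS').
  rewrite (_ : (fun N => _) = fun N => zsum C N (theta (P - 1)) * (I * I)).
    exact: (cvgM thetaT (cvg_cst (I * I))).
  by apply/funext => N; rewrite [RHS]mulrC mulr_zsumr; apply: eq_zsum => j; rewrite [LHS]mulrC.
have W : (fun N => \sum_(s < N) q ^ (s%:Z * s%:Z) * beta' s) @ \oo --> T * I.
  rewrite (_ : T * I = S * I^-1); last by rewrite SS' S'T mulrA mulfK.
  rewrite (_ : (fun N => _) = fun N => (\sum_(s < N) q ^ (s%:Z * s%:Z) * beta' s * I) * I^-1).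
    exact: (cvgM gS (cvg_cst I^-1)).
  by apply/funext => N; rewrite -mulr_suml mulfK.
pose w N := \sum_(s < N) q ^ (s%:Z * s%:Z) * beta' s.
rewrite (_ : (fun N => _) = (fun N => box_sum (n + 5 - 2) N (summand (n + 5) q) - w N + w N)).
  by have := cvgD cvg_box_sub W; rewrite add0r; apply.
by apply/funext => N; rewrite subrK.
Qed.

End MultisumLimit.

(** * The case q = 0 and the conclusion *)

Lemma qpoch0l (C : numFieldType) (x : C) N : qpoch 0 x N = 1.
Proof. by rewrite /qpoch big1 // => i _; rewrite mul0r subr0. Qed.

Lemma burge_tree00 (C : numFieldType) (x : C) n : burge_tree C x n 0 0 = 1.
Proof.
have b00 : qbinom x 0 0 = 1 by rewrite /qbinom /= qpoch0 mulr1 divr1.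
elim: n => [|n IH] /=; first by rewrite mul0n expr0 mul1r.
by rewrite big_ord1 expr0 mul1r [burge_tree _ _ _ _ _]IH mulr1.
Qed.

(** With 0^0 = 1, only the term with all variables zero survives; the side N + 1 keeps it inside the
    box. *)
Lemma box_sum_summand0 (C : numFieldType) n N :
  box_sum (n + 5 - 2) N.+1 (summand (n + 5) (0 : C)) = 1.
Proof.
rewrite box_sum_summand big_ord_recl [X in _ + X]big1 => [|m1 _]; last first.
  by apply: big1 => m2 _; rewrite expr0n !mul0r.
rewrite addr0 big_ord_recl [X in _ + X]big1 => [|m2 _]; last by rewrite expr0n !mul0r.
by rewrite /burge_root big_ord1 /= burge_tree00 !qpoch0l expr0 !mulr1 divr1 !addr0.
Qed.

Theorem theorem1p7 (R : realType) (q : R[i]) (k : nat) :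
  `|q| < 1 -> (5 <= k)%N ->
  (fun N : nat => box_sum (k - 2) N (summand k q)) @ \oo -->
    (let P := (fib k * fib (k - 2))%N in
     qpoch_inf (q ^+ (P - 1)) (q ^+ (2 * P - 1))
     * qpoch_inf (q ^+ P) (q ^+ (2 * P - 1))
     * qpoch_inf (q ^+ (2 * P - 1)) (q ^+ (2 * P - 1))
     / qpoch_inf q q).
Proof.
move=> q1 k5; have [n ->] : exists n, k = (n + 5)%N by exists (k - 5)%N; lia.
cbv zeta; set P := (fib (n + 5) * fib (n + 5 - 2))%N.
have PE : P = (fib n.+3 * fib n.+4.+1)%N.
  rewrite mulnC /P; have -> : (n + 5 - 2 = n.+3)%N by lia.
  by have -> : (n + 5 = n.+4.+1)%N by lia.
have P1 : (1 < P)%N.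
  by rewrite PE (fibSS n.+3) mulnDr; have := fib_coef_gt0 n.+1; lia.
have q_lt1 : cmod R q < 1 by rewrite -ltcR -cmodE.
(* The finite identities use negative powers of q, so q = 0 is treated apart. *)
have [q0|q0] := eqVneq q 0.
  have one x : qpoch_inf (0 : complex_complex__canonical__Num_NumField R) x = 1.
    rewrite /qpoch_inf (_ : qpoch 0 x = fun=> 1); last by apply/funext => N; rewrite qpoch0l.
    by apply: cvg_lim; [exact: norm_hausdorff|exact: cvg_cst].
  have z m : (0 < m)%N -> (0 : complex_complex__canonical__Num_NumField R) ^+ m = 0.
    by case: m => // m _; rewrite expr0n.
  (* All exponents are positive because P > 1, so every numerator product has first argument 0 and
     equals 1. *)
  rewrite q0 !z; try lia.
  rewrite !one !mulr1 divr1.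
  apply: (cvg_near_cst); exists 1%N => // N /= N0.
  by rewrite -(prednK N0) box_sum_summand0.
have := cvg_theta R q P q_lt1 q0 P1; rewrite PE => h.
exact: (cvg_box_sum R q n q_lt1 q0 _ h).
Qed.
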